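(* Being a connected CSC space is $\Pi^1_1$ universal over $\mathbf{ACA}_0$.
   Context: All notions are formalized in second order arithmetic. CSC space: a tuple $(X,(U_i)_{i\in\mathbb{N}},k)$ with $X\subseteq\mathbb{N}$, $(U_i)$ a sequence of subsets of $X$ such that every $x\in X$ lies in some $U_i$, and $k:X\times\mathbb{N}\times\mathbb{N}\to\mathbb{N}$ a partial function such that $x\in U_i\cap U_j$ implies $x\in U_{k(x,i,j)}\subseteq U_i\cap U_j$. A set $A\subseteq X$ is open if for all $x\in A$ there is $i$ with $x\in U_i\subseteq A$. $X$ is connected if for all nonempty open sets $A,B$ with $X=A\cup B$ one has $A\cap B\neq\emptyset$. A property $P$ of objects coded by sets is $\Pi^1_1$ universal over $\mathbf{ACA}_0$ if $\mathbf{ACA}_0$ proves $P$ equivalent to a $\Pi^1_1$ formula, and for every $\Pi^1_1$ formula $\varphi(Z)$ there is an arithmetical definition of an object $M_Z$ from $Z$ such that $\mathbf{ACA}_0$ proves $\forall Z\,(\varphi(Z)\leftrightarrow P(M_Z))$. *)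

(* Defs.v *)
From Stdlib Require Import List.
Import ListNotations.

Set Implicit Arguments.


(** Both sorts use de Bruijn indices, in two independent name spaces: a number
    quantifier only shifts number indices, a set quantifier only set indices. *)

Inductive term : Type :=
| tvar  : nat -> term
| tzero : term
| tone  : term
| tplus : term -> term -> term
| tmult : term -> term -> term.

Inductive formula : Type :=
| fbot : formula
| feq  : term -> term -> formula
| flt  : term -> term -> formula
| fmem : term -> nat -> formula
| fimp : formula -> formula -> formula
| falln : formula -> formula
| falls : formula -> formula.

Definition fnot (A : formula) : formula := fimp A fbot.
Definition fand (A B : formula) : formula := fnot (fimp A (fnot B)).
Definition for_ (A B : formula) : formula := fimp (fnot A) B.
Definition fiff (A B : formula) : formula := fand (fimp A B) (fimp B A).
Definition fexn (A : formula) : formula := fnot (falln (fnot A)).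
Definition fexs (A : formula) : formula := fnot (falls (fnot A)).

Declare Scope term_scope.
Delimit Scope term_scope with t.
Bind Scope term_scope with term.
Declare Scope formula_scope.
Delimit Scope formula_scope with f.
Bind Scope formula_scope with formula.

Notation "'#' n" := (tvar n) (at level 1, n at level 0, format "# n") : term_scope.
Notation "0" := tzero : term_scope.
Notation "1" := tone : term_scope.
Notation "2" := (tplus tone tone) : term_scope.
Notation "s + t" := (tplus s t) : term_scope.
Notation "s * t" := (tmult s t) : term_scope.

Notation "⊥" := fbot : formula_scope.
Notation "s ≐ t" := (feq s t) (at level 70, no associativity) : formula_scope.
Notation "s ≺ t" := (flt s t) (at level 70, no associativity) : formula_scope.
Notation "t ∈ X" := (fmem t X) (at level 70, no associativity) : formula_scope.
Notation "¬ A" := (fnot A) (at level 75, right associativity) : formula_scope.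
Notation "A ∧ B" := (fand A B) (at level 80, right associativity) : formula_scope.
Notation "A ∨ B" := (for_ A B) (at level 85, right associativity) : formula_scope.
Notation "A ⇒ B" := (fimp A B) (at level 90, right associativity) : formula_scope.
Notation "A ⇔ B" := (fiff A B) (at level 95, no associativity) : formula_scope.
Notation "∀N A" := (falln A) (at level 200, A at level 200) : formula_scope.
Notation "∃N A" := (fexn A) (at level 200, A at level 200) : formula_scope.
Notation "∀S A" := (falls A) (at level 200, A at level 200) : formula_scope.
Notation "∃S A" := (fexs A) (at level 200, A at level 200) : formula_scope.


Fixpoint tsubst (s : nat -> term) (t : term) : term :=
  match t with
  | tvar n => s n
  | tzero => tzero
  | tone => tone
  | tplus a b => tplus (tsubst s a) (tsubst s b)
  | tmult a b => tmult (tsubst s a) (tsubst s b)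
  end.

Definition scons {A : Type} (a : A) (s : nat -> A) (n : nat) : A :=
  match n with O => a | S m => s m end.

Definition tshift : nat -> term := fun n => tvar (S n).

Definition up_num (s : nat -> term) : nat -> term :=
  scons (tvar 0) (fun n => tsubst tshift (s n)).
Definition up_set (r : nat -> nat) : nat -> nat :=
  scons 0 (fun n => S (r n)).

(** The only set terms are set variables, so on the set side a substitution is
    a renaming. *)
Fixpoint subst (s : nat -> term) (r : nat -> nat) (A : formula) : formula :=
  match A with
  | fbot => fbot
  | feq a b => feq (tsubst s a) (tsubst s b)
  | flt a b => flt (tsubst s a) (tsubst s b)
  | fmem a X => fmem (tsubst s a) (r X)
  | fimp B C => fimp (subst s r B) (subst s r C)
  | falln B => falln (subst (up_num s) r B)
  | falls B => falls (subst s (up_set r) B)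
  end.

Definition shift_num (A : formula) : formula := subst tshift (fun X => X) A.
Definition shift_set (A : formula) : formula := subst tvar S A.
Definition inst_num (t : term) (A : formula) : formula :=
  subst (scons t tvar) (fun X => X) A.
Definition inst_set (Y : nat) (A : formula) : formula :=
  subst tvar (scons Y (fun X => X)) A.


Fixpoint tbounded (k : nat) (t : term) : Prop :=
  match t with
  | tvar n => n < k
  | tzero | tone => True
  | tplus a b | tmult a b => tbounded k a /\ tbounded k b
  end.

(** [bounded k l A]: the free number variables of [A] are among the indices
    [0, ..., k-1] and its free set variables among [0, ..., l-1]. *)
Fixpoint bounded (k l : nat) (A : formula) : Prop :=
  match A with
  | fbot => True
  | feq a b | flt a b => tbounded k a /\ tbounded k b
  | fmem a X => tbounded k a /\ X < l
  | fimp B C => bounded k l B /\ bounded k l C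
  | falln B => bounded (S k) l B
  | falls B => bounded k (S l) B
  end.

Fixpoint arithmetical (A : formula) : Prop :=
  match A with
  | fbot | feq _ _ | flt _ _ | fmem _ _ => True
  | fimp B C => arithmetical B /\ arithmetical C
  | falln B => arithmetical B
  | falls _ => False
  end.

Definition Pi11 (A : formula) : Prop :=
  exists B, arithmetical B /\ A = falls B.


(** Classical two-sorted natural deduction with equality on numbers.  The
    axioms in [T] may have free variables; they can be generalised in the empty
    context, hence are used as their universal closures. *)
Inductive derives (T : formula -> Prop) : list formula -> formula -> Prop :=
| d_axiom G A : T A -> derives T G A
| d_hyp G A : In A G -> derives T G A
| d_impI G A B : derives T (A :: G) B -> derives T G (A ⇒ B)%f
| d_impE G A B : derives T G (A ⇒ B)%f -> derives T G A -> derives T G B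
| d_raa G A : derives T ((¬ A)%f :: G) fbot -> derives T G A
| d_allnI G A : derives T (map shift_num G) A -> derives T G (falln A)
| d_allnE G A t : derives T G (falln A) -> derives T G (inst_num t A)
| d_allsI G A : derives T (map shift_set G) A -> derives T G (falls A)
| d_allsE G A Y : derives T G (falls A) -> derives T G (inst_set Y A)
| d_eq_refl G t : derives T G (t ≐ t)%f
| d_eq_subst G A s t :
    derives T G (s ≐ t)%f -> derives T G (inst_num s A) ->
    derives T G (inst_num t A).

Definition proves (T : formula -> Prop) (A : formula) : Prop := derives T [] A.


Inductive ACA0 : formula -> Prop :=
| ax_succ_neq0 : ACA0 (∀N ¬ (#0 + 1 ≐ 0))
| ax_succ_inj : ACA0 (∀N ∀N (#1 + 1 ≐ #0 + 1 ⇒ #1 ≐ #0))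
| ax_plus0 : ACA0 (∀N (#0 + 0 ≐ #0))
| ax_plusS : ACA0 (∀N ∀N (#1 + (#0 + 1) ≐ (#1 + #0) + 1))
| ax_mult0 : ACA0 (∀N (#0 * 0 ≐ 0))
| ax_multS : ACA0 (∀N ∀N (#1 * (#0 + 1) ≐ #1 * #0 + #1))
| ax_lt0 : ACA0 (∀N ¬ (#0 ≺ 0))
| ax_ltS : ACA0 (∀N ∀N (#1 ≺ #0 + 1 ⇔ (#1 ≺ #0 ∨ #1 ≐ #0)))
| ax_induction :
    ACA0 (∀S ((0 ∈ 0 ∧ (∀N (#0 ∈ 0 ⇒ #0 + 1 ∈ 0))) ⇒ ∀N (#0 ∈ 0)))
(* [A] may have further free variables of both sorts (parameters); the shift
   makes the set being defined not free in it. *)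
| ax_comprehension (A : formula) :
    arithmetical A -> ACA0 (∃S ∀N (#0 ∈ 0 ⇔ shift_set A)).


(** [P] has the single free set variable 0, standing for the code of the object.
    In the second part [D] has number variable 0 and set variable 0 free, and
    [M_Z = {n : D(n,Z)}].  Under the two set quantifiers [Z] is set variable 1
    and [M_Z] is set variable 0. *)
Definition Pi11_universal (P : formula) : Prop :=
  (exists Q, Pi11 Q /\ bounded 0 1 Q /\ proves ACA0 (∀S (P ⇔ Q))) /\
  (forall F, Pi11 F -> bounded 0 1 F ->
     exists D, arithmetical D /\ bounded 1 1 D /\
       proves ACA0
         (∀S ∃S ((∀N (#0 ∈ 0 ⇔ shift_set D)) ∧ (shift_set F ⇔ P)))).


(** The pairing map [(i,j) = (i+j)^2 + i], injective on numbers. *)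
Definition tpair (i j : term) : term := ((i + j) * (i + j) + i)%t.

(** A set [M] codes the triple [(X, U, K)] of its columns
    [{n : (n,0) ∈ M}], [{n : (n,1) ∈ M}] and [{n : (n,2) ∈ M}], where
    [U_i = {x : (x,i) ∈ U}] and [K] is the graph of the partial function [k],
    its elements being of the form [(((x,i),j),y)] with [k(x,i,j) = y]. *)
Definition in_space (M : nat) (x : term) : formula := (tpair x 0 ∈ M)%f.
Definition in_nbhd (M : nat) (x i : term) : formula :=
  (tpair (tpair x i) 1 ∈ M)%f.
Definition tquad (x i j y : term) : term := tpair (tpair (tpair x i) j) y.
Definition in_graph (M : nat) (n : term) : formula := (tpair n 2 ∈ M)%f.
Definition k_eq (M : nat) (x i j y : term) : formula :=
  in_graph M (tquad x i j y).

Definition nbhds_in_space (M : nat) : formula :=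
  ∀N ∀N let x := #1%t in let i := #0%t in
    in_nbhd M x i ⇒ in_space M x.

Definition nbhds_cover (M : nat) : formula :=
  ∀N (in_space M #0 ⇒
      ∃N let x := #1%t in let i := #0%t in in_nbhd M x i).

Definition k_partial_function (M : nat) : formula :=
  (∀N (in_graph M #0 ⇒
       ∃N ∃N ∃N ∃N
         let n := #4%t in let x := #3%t in let i := #2%t in
         let j := #1%t in let y := #0%t in
         n ≐ tquad x i j y ∧ in_space M x)) ∧
  (∀N ∀N ∀N ∀N ∀N
     let x := #4%t in let i := #3%t in let j := #2%t in
     let y := #1%t in let z := #0%t in
     k_eq M x i j y ⇒ k_eq M x i j z ⇒ y ≐ z).

Definition k_intersection (M : nat) : formula :=
  ∀N ∀N ∀N
    ((let x := #2%t in let i := #1%t in let j := #0%t in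
      in_nbhd M x i ∧ in_nbhd M x j) ⇒
     ∃N ((let x := #3%t in let i := #2%t in let j := #1%t in
          let y := #0%t in
          k_eq M x i j y ∧ in_nbhd M x y) ∧
         ∀N let i := #3%t in let j := #2%t in
            let y := #1%t in let z := #0%t in
            in_nbhd M z y ⇒ (in_nbhd M z i ∧ in_nbhd M z j))).

Definition CSC_space (M : nat) : formula :=
  nbhds_in_space M ∧ nbhds_cover M ∧ k_partial_function M ∧ k_intersection M.

Definition open_in (M A : nat) : formula :=
  (∀N (#0 ∈ A ⇒ in_space M #0)) ∧
  (∀N (#0 ∈ A ⇒
       ∃N ((let x := #1%t in let i := #0%t in in_nbhd M x i) ∧
           ∀N let i := #1%t in let z := #0%t in
              in_nbhd M z i ⇒ z ∈ A))).

Definition nonempty (A : nat) : formula := ∃N (#0 ∈ A).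

(** Under the two set quantifiers, [A] is set variable 1, [B] is set variable 0
    and the space is set variable [2 + M]. *)
Definition connected (M : nat) : formula :=
  ∀S ∀S
    let A := 1 in let B := 0 in let X := S (S M) in
    (open_in X A ∧ open_in X B ∧ nonempty A ∧ nonempty B ∧
     (∀N (in_space X #0 ⇔ (#0 ∈ A ∨ #0 ∈ B)))) ⇒
    ∃N (#0 ∈ A ∧ #0 ∈ B).

Definition connected_CSC_space : formula := CSC_space 0 ∧ connected 0.

(* Main.v *)
(** Completeness of the deductive system (Henkin's construction) reduces provability in
    ACA0 to truth in an arbitrary structure [M] for ACA0, where all arguments below take
    place.

    Two set quantifiers merge into one, so being a connected CSC space is Pi^1_1.
    Conversely let [forall Y, C(Y, Z)] be Pi^1_1 with [C] arithmetical.  A counterexample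
    [Y] together with the truth valuation of [C] is a set [V] satisfying a condition
    "for all x there is y" on finite parts of [V].  Call a finite set [c] of numbers a
    node if some finite [s] satisfies, for all [v < w] in [c], the instances up to [v] of
    that condition using only [s] below [w].  If [V] exists, then the [c] which [V] itself
    makes a node form a nonempty set of nodes that contains, with [c], the sets [c + {w}]
    for almost all [w].  Conversely, in a nonempty set of nodes with the latter property one
    finds an infinite set all of whose initial segments are nodes, and weak König's lemma
    yields [V].  Only "almost all" occurs here, and not "some", so that such sets of
    nodes are the nontrivial clopen sets of a second countable space: tie a limit point
    to [c] and to the sequence of its children, and identify all non-nodes. *)
From Stdlib Require Import List Arith Lia Classical ClassicalEpsilon
  FunctionalExtensionality PropExtensionality Cantor Ring.
Require Import Defs.
Import ListNotations.
Set Implicit Arguments.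

(** * Substitution *)

(** The obstacle is that in the natural tree of attempts at [V] an attempt survives if some child
    does, while countably many neighbourhoods express only closure under almost all children. So a
    node records bounds instead of [V]: it lists stages so far apart that the later of two decides
    all instances up to the earlier one. Such a list may be thinned or made to grow faster at will,
    and [V] itself is recovered by compactness, since below a bound only finitely many possibilities
    remain. Every [c] gets two points so that a neighbourhood of a limit point adds isolated points
    only. Had it to contain neighbourhoods of the children too, it would involve a bound for every
    descendant, and such families are not coded by numbers. Non-nodes are identified so that one
    side of any separation contains nodes only. The formula [C] lives outside a structure whose
    numbers may be nonstandard. Truth valuations therefore arise by induction on [C] outside the
    structure, and one formula has to define the space in all structures at once; this is why
    predicates are reified as formulas. *)

Lemma tsubst_comp s1 s2 t :
  tsubst s2 (tsubst s1 t) = tsubst (fun n => tsubst s2 (s1 n)) t.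
Proof. induction t; simpl; congruence. Qed.

Lemma tsubst_id t : tsubst tvar t = t.
Proof. induction t; simpl; congruence. Qed.

Lemma up_num_comp s1 s2 :
  (fun n => tsubst (up_num s2) (up_num s1 n)) = up_num (fun n => tsubst s2 (s1 n)).
Proof.
  apply functional_extensionality; intros [|n]; simpl; [reflexivity|].
  now rewrite !tsubst_comp.
Qed.

Lemma up_set_comp r1 r2 :
  (fun n => up_set r2 (up_set r1 n)) = up_set (fun n => r2 (r1 n)).
Proof. apply functional_extensionality; now intros [|n]. Qed.

Lemma up_num_id : up_num tvar = tvar.
Proof. apply functional_extensionality; now intros [|n]. Qed.

Lemma up_set_id : up_set (fun X => X) = (fun X => X).
Proof. apply functional_extensionality; now intros [|n]. Qed.

Lemma subst_comp A : forall s1 r1 s2 r2,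
  subst s2 r2 (subst s1 r1 A)
  = subst (fun n => tsubst s2 (s1 n)) (fun X => r2 (r1 X)) A.
Proof.
  induction A; intros; simpl; rewrite ?tsubst_comp; try congruence.
  - now rewrite IHA1, IHA2.
  - now rewrite IHA, up_num_comp.
  - now rewrite IHA, up_set_comp.
Qed.

Lemma subst_id A : subst tvar (fun X => X) A = A.
Proof.
  induction A; simpl; rewrite ?tsubst_id; try congruence.
  - now rewrite up_num_id, IHA.
  - now rewrite up_set_id, IHA.
Qed.

Lemma tsubst_bounded k t : tbounded k t -> forall s s',
  (forall n, n < k -> s n = s' n) -> tsubst s t = tsubst s' t.
Proof.
  induction t; simpl; intros Hb s s' Hs; auto;
    destruct Hb; erewrite IHt1, IHt2; eauto.
Qed.

Lemma subst_bounded A : forall k l, bounded k l A -> forall s s' r r',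
  (forall n, n < k -> s n = s' n) -> (forall X, X < l -> r X = r' X) ->
  subst s r A = subst s' r' A.
Proof.
  induction A; simpl; intros k l Hb s s' r r' Hs Hr;
    try (destruct Hb; f_equal; eauto using tsubst_bounded; fail).
  - f_equal; eapply IHA; eauto. intros [|n] Hn; simpl; [reflexivity|].
    rewrite Hs by lia; reflexivity.
  - f_equal; eapply IHA; eauto. intros [|n] Hn; simpl; [reflexivity|].
    rewrite Hr by lia; reflexivity.
Qed.

Lemma tbounded_mono k k' t : tbounded k t -> k <= k' -> tbounded k' t.
Proof. induction t; simpl; intuition lia. Qed.

Lemma bounded_mono A : forall k l k' l',
  bounded k l A -> k <= k' -> l <= l' -> bounded k' l' A.
Proof.
  induction A; simpl; intros k l k' l' Hb Hk Hl; auto;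
    try (destruct Hb; split; eauto using tbounded_mono; lia);
    eapply IHA; eauto; lia.
Qed.

Lemma tbounded_exists t : exists k, tbounded k t.
Proof.
  induction t as [n| | |a [k Hk] b [k' Hk']|a [k Hk] b [k' Hk']].
  1: exists (S n); simpl; lia.
  1,2: exists O; exact I.
  all: exists (k + k'); split; eapply tbounded_mono; eauto; lia.
Qed.

Lemma bounded_exists A : exists k, bounded k k A.
Proof.
  induction A as [|a b|a b|a X|A [k Hk] B [k' Hk']|A [k Hk]|A [k Hk]].
  - now exists O.
  - destruct (tbounded_exists a) as [k Hk], (tbounded_exists b) as [k' Hk'].
    exists (k + k'); split; eapply tbounded_mono; eauto; lia.
  - destruct (tbounded_exists a) as [k Hk], (tbounded_exists b) as [k' Hk'].
    exists (k + k'); split; eapply tbounded_mono; eauto; lia.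
  - destruct (tbounded_exists a) as [k Hk].
    exists (k + S X); split; [eapply tbounded_mono; eauto|]; lia.
  - exists (k + k'); split; eapply bounded_mono; eauto; lia.
  - exists k; simpl; eapply bounded_mono; eauto; lia.
  - exists k; simpl; eapply bounded_mono; eauto; lia.
Qed.

Lemma bounded_exists_list G : exists k, forall A, In A G -> bounded k k A.
Proof.
  induction G as [|A G [k Hk]]; [now exists O|].
  destruct (bounded_exists A) as [k' Hk'].
  exists (k + k'); intros B [<-|HB]; eapply bounded_mono; eauto; lia.
Qed.

Lemma arithmetical_subst A : forall s r,
  arithmetical A -> arithmetical (subst s r A).
Proof. induction A; simpl; intuition. Qed.

Lemma tbounded_subst k s t :
  (forall n, tbounded k (s n)) -> tbounded k (tsubst s t).
Proof. intros Hs; induction t; simpl; auto. Qed.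

Lemma bounded_subst A : forall k l s r,
  (forall n, tbounded k (s n)) -> (forall X, r X < l) ->
  bounded k l (subst s r A).
Proof.
  induction A; simpl; intros k l s r Hs Hr; auto using tbounded_subst.
  - apply IHA; auto. intros [|n]; simpl; [lia|].
    generalize (Hs n). generalize (s n). intros t; induction t; simpl; intuition lia.
  - apply IHA; auto. intros [|n]; simpl; [lia|].
    generalize (Hr n); lia.
Qed.

(** * Derivations *)

Lemma weakening T G A : derives T G A -> forall G', incl G G' -> derives T G' A.
Proof.
  induction 1; intros G' HG.
  - now apply d_axiom.
  - now apply d_hyp, HG.
  - apply d_impI, IHderives. intros C [<-|HC]; simpl; auto.
  - eapply d_impE; eauto.
  - apply d_raa, IHderives. intros C [<-|HC]; simpl; auto.
  - apply d_allnI, IHderives. now apply incl_map.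
  - now apply d_allnE, IHderives.
  - apply d_allsI, IHderives. now apply incl_map.
  - now apply d_allsE, IHderives.
  - apply d_eq_refl.
  - eapply d_eq_subst; eauto.
Qed.

(** Renaming variables in a derivation replaces its axioms by substitution instances, which must
    again be axioms. *)
Definition subst_closed (T : formula -> Prop) : Prop :=
  forall A s r, T A -> T (subst s r A).

Lemma subst_shift_num A s r :
  subst (up_num s) r (shift_num A) = shift_num (subst s r A).
Proof. unfold shift_num; now rewrite !subst_comp. Qed.

Lemma subst_shift_set A s r :
  subst s (up_set r) (shift_set A) = shift_set (subst s r A).
Proof.
  unfold shift_set; rewrite !subst_comp; f_equal.
  apply functional_extensionality; intros n; now rewrite tsubst_id.
Qed.

Lemma subst_inst_num A t s r :
  subst s r (inst_num t A) = inst_num (tsubst s t) (subst (up_num s) r A).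
Proof.
  unfold inst_num; rewrite !subst_comp; f_equal.
  apply functional_extensionality; intros [|n]; simpl; [reflexivity|].
  rewrite tsubst_comp; simpl; now rewrite tsubst_id.
Qed.

Lemma subst_inst_set A Y s r :
  subst s r (inst_set Y A) = inst_set (r Y) (subst s (up_set r) A).
Proof.
  unfold inst_set; rewrite !subst_comp; f_equal.
  - apply functional_extensionality; intros n; simpl; now rewrite tsubst_id.
  - apply functional_extensionality; now intros [|n].
Qed.

Lemma inst_num_up t s r A :
  inst_num t (subst (up_num s) r A) = subst (scons t s) r A.
Proof.
  unfold inst_num; rewrite subst_comp; f_equal.
  apply functional_extensionality; intros [|n]; simpl; [reflexivity|].
  rewrite tsubst_comp; simpl; now rewrite tsubst_id.
Qed.

Lemma inst_set_up Y s r A :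
  inst_set Y (subst s (up_set r) A) = subst s (scons Y r) A.
Proof.
  unfold inst_set; rewrite subst_comp; f_equal.
  - apply functional_extensionality; intros n; now rewrite tsubst_id.
  - apply functional_extensionality; now intros [|n].
Qed.

Lemma derives_subst T G A : subst_closed T -> derives T G A ->
  forall s r, derives T (map (subst s r) G) (subst s r A).
Proof.
  intros HT; induction 1; intros p r.
  - now apply d_axiom, HT.
  - now apply d_hyp, in_map.
  - apply d_impI, IHderives.
  - eapply d_impE; [apply (IHderives1 p r)|apply IHderives2].
  - apply d_raa, (IHderives p r).
  - apply d_allnI. rewrite map_map.
    erewrite map_ext; [|intros B; symmetry; apply subst_shift_num].
    rewrite <- map_map; apply IHderives.
  - rewrite subst_inst_num. apply d_allnE, (IHderives p r).
  - apply d_allsI. rewrite map_map.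
    erewrite map_ext; [|intros B; symmetry; apply subst_shift_set].
    rewrite <- map_map; apply IHderives.
  - rewrite subst_inst_set. apply d_allsE, (IHderives p r).
  - apply d_eq_refl.
  - rewrite subst_inst_num. eapply d_eq_subst; [apply (IHderives1 p r)|].
    rewrite <- subst_inst_num; apply IHderives2.
Qed.

(** * Fresh witnesses and a numbering of the formulas *)

Definition consistent (T : formula -> Prop) (G : list formula) : Prop :=
  ~ derives T G fbot.

(** A context is finite, so a variable above all its free variables can be the witness and the
    language needs no new constants. A refutation with this witness becomes, after renaming, the
    premise of [d_allnI]. *)
Lemma consistent_num_witness T G B : subst_closed T ->
  consistent T (fnot (falln B) :: G) ->
  exists t, consistent T (fnot (inst_num t B) :: fnot (falln B) :: G).
Proof.
  intros HT HG.
  destruct (bounded_exists_list (fnot (falln B) :: G)) as [k Hk].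
  exists (tvar k); intros HD; apply HG.
  eapply d_impE; [apply d_hyp; now left|].
  apply d_allnI. apply d_raa in HD.
  (* On formulas with variables below [k] this is the shift, and it turns the instance at [k] back
     into [B]. *)
  set (s := fun n => if Nat.eq_dec n k then tvar 0 else tvar (S n)).
  apply (derives_subst HT) with (s := s) (r := fun X => X) in HD.
  assert (E : map (subst s (fun X => X)) (fnot (falln B) :: G)
              = map shift_num (fnot (falln B) :: G)).
  { apply map_ext_in; intros C HC. eapply subst_bounded; [apply Hk; eassumption| |reflexivity].
    intros n Hn; unfold s, tshift. destruct (Nat.eq_dec n k); [lia|reflexivity]. }
  rewrite E in HD; clear E.
  replace B with (subst s (fun X => X) (inst_num (tvar k) B)) at 2; [exact HD|].
  unfold inst_num. rewrite subst_comp. rewrite <- (subst_id B) at 2.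
  destruct (Hk _ (or_introl eq_refl)) as [HB _]; simpl in HB.
  eapply subst_bounded; [exact HB| |reflexivity].
  intros [|n] Hn; unfold s; simpl.
  - destruct (Nat.eq_dec k k); [reflexivity|lia].
  - destruct (Nat.eq_dec n k); [lia|reflexivity].
Qed.

Lemma consistent_set_witness T G B : subst_closed T ->
  consistent T (fnot (falls B) :: G) ->
  exists Y, consistent T (fnot (inst_set Y B) :: fnot (falls B) :: G).
Proof.
  intros HT HG.
  destruct (bounded_exists_list (fnot (falls B) :: G)) as [k Hk].
  exists k; intros HD; apply HG.
  eapply d_impE; [apply d_hyp; now left|].
  apply d_allsI. apply d_raa in HD.
  set (r := fun n => if Nat.eq_dec n k then 0 else S n).
  apply (derives_subst HT) with (s := tvar) (r := r) in HD.
  assert (E : map (subst tvar r) (fnot (falls B) :: G)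
              = map shift_set (fnot (falls B) :: G)).
  { apply map_ext_in; intros C HC. eapply subst_bounded; [apply Hk; eassumption|reflexivity|].
    intros n Hn; unfold r. destruct (Nat.eq_dec n k); [lia|reflexivity]. }
  rewrite E in HD; clear E.
  replace B with (subst tvar r (inst_set k B)) at 2; [exact HD|].
  unfold inst_set. rewrite subst_comp. rewrite <- (subst_id B) at 2.
  destruct (Hk _ (or_introl eq_refl)) as [HB _]; simpl in HB.
  eapply subst_bounded; [exact HB|reflexivity|].
  intros [|n] Hn; unfold r; simpl.
  - destruct (Nat.eq_dec k k); [reflexivity|lia].
  - destruct (Nat.eq_dec n k); [lia|reflexivity].
Qed.

(** Injectivity is all that the enumeration of formulas requires; [nth_formula] inverts the code by
    choice. *)
Fixpoint tcode (t : term) : nat :=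
  match t with
  | tvar n => to_nat (0, n)
  | tzero => to_nat (1, 0)
  | tone => to_nat (2, 0)
  | tplus a b => to_nat (3, to_nat (tcode a, tcode b))
  | tmult a b => to_nat (4, to_nat (tcode a, tcode b))
  end.

Fixpoint fcode (A : formula) : nat :=
  match A with
  | fbot => to_nat (0, 0)
  | feq a b => to_nat (1, to_nat (tcode a, tcode b))
  | flt a b => to_nat (2, to_nat (tcode a, tcode b))
  | fmem a X => to_nat (3, to_nat (tcode a, X))
  | fimp B C => to_nat (4, to_nat (fcode B, fcode C))
  | falln B => to_nat (5, fcode B)
  | falls B => to_nat (6, fcode B)
  end.

Lemma to_nat_pair a b c d : to_nat (a, b) = to_nat (c, d) -> a = c /\ b = d.
Proof. intros H; apply to_nat_inj in H; now injection H. Qed.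

Ltac code_inv :=
  repeat match goal with
  | H : to_nat (_, _) = to_nat (_, _) |- _ => apply to_nat_pair in H; destruct H
  end; try discriminate.

Lemma tcode_inj t : forall u, tcode t = tcode u -> t = u.
Proof.
  induction t; intros []; cbn [tcode]; intros H; code_inv; subst; auto;
    f_equal; auto.
Qed.

Lemma fcode_inj A : forall B, fcode A = fcode B -> A = B.
Proof.
  induction A; intros []; cbn [fcode]; intros H; code_inv; subst; auto;
    f_equal; auto using tcode_inj.
Qed.

(** * Two-sorted structures *)

Record structure : Type := {
  num : Type;
  set : Type;
  nzero : num;
  none : num;
  nadd : num -> num -> num;
  nmul : num -> num -> num;
  nlt : num -> num -> Prop;
  nmem : num -> set -> Prop
}.

Fixpoint eval (M : structure) (rho : nat -> num M) (t : term) : num M :=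
  match t with
  | tvar n => rho n
  | tzero => nzero M
  | tone => none M
  | tplus a b => nadd M (eval M rho a) (eval M rho b)
  | tmult a b => nmul M (eval M rho a) (eval M rho b)
  end.

Fixpoint sat (M : structure) (rho : nat -> num M) (sig : nat -> set M)
    (A : formula) : Prop :=
  match A with
  | fbot => False
  | feq a b => eval M rho a = eval M rho b
  | flt a b => nlt M (eval M rho a) (eval M rho b)
  | fmem a X => nmem M (eval M rho a) (sig X)
  | fimp B C => sat M rho sig B -> sat M rho sig C
  | falln B => forall x, sat M (scons x rho) sig B
  | falls B => forall X, sat M rho (scons X sig) B
  end.

Definition models (T : formula -> Prop) (M : structure) : Prop :=
  forall A, T A -> forall rho sig, sat M rho sig A.

(** * The term model of a consistent context *)

Section Henkin.
Variable T : formula -> Prop.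
Hypothesis T_subst : subst_closed T.
Variable G0 : list formula.
Hypothesis G0_consistent : consistent T G0.

Let ctx := {G : list formula | consistent T G}.

(** [A] is added whenever that is consistent; otherwise the context already derives its negation and
    can stay as it is. Contexts remain finite, so a fresh witness is always at hand. *)
Lemma henkin_step (G : ctx) (A : formula) : exists G' : ctx,
  incl (proj1_sig G) (proj1_sig G') /\
  (In A (proj1_sig G') \/ derives T (proj1_sig G) (fnot A)) /\
  (forall B, A = fnot (falln B) -> In A (proj1_sig G') ->
     exists t, In (fnot (inst_num t B)) (proj1_sig G')) /\
  (forall B, A = fnot (falls B) -> In A (proj1_sig G') ->
     exists Y, In (fnot (inst_set Y B)) (proj1_sig G')).
Proof.
  destruct G as [G HG]; simpl.
  destruct (classic (consistent T (A :: G))) as [HA|HA].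
  - destruct (classic (exists B, A = fnot (falln B))) as [[B ->]|Hn].
    + destruct (consistent_num_witness T_subst HA) as [t Ht].
      exists (exist _ _ Ht); simpl. repeat split; auto.
      * intros C HC; simpl; auto.
      * intros B' E _; injection E as <-; eauto.
      * intros B' E; discriminate.
    + destruct (classic (exists B, A = fnot (falls B))) as [[B ->]|Hs].
      * destruct (consistent_set_witness T_subst HA) as [t Ht].
        exists (exist _ _ Ht); simpl. repeat split; auto.
        -- intros C HC; simpl; auto.
        -- intros B' E; discriminate.
        -- intros B' E _; injection E as <-; eauto.
      * exists (exist _ _ HA); simpl. repeat split; auto.
        -- intros C HC; simpl; auto.
        -- intros B' E; destruct Hn; eauto.
        -- intros B' E; destruct Hs; eauto.
  - exists (exist _ _ HG); simpl.
    assert (D : derives T G (fnot A)) by now apply d_impI, NNPP.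
    (* A formula inconsistent with [G] cannot occur in [G], so both witness clauses are vacuous. *)
    assert (Hin : ~ In A G).
    { intros Hin; apply HG; eapply d_impE; [exact D|now apply d_hyp]. }
    repeat split; auto; try (intros C HC; exact HC); now intros.
Qed.

Let step : ctx -> formula -> ctx :=
  fun G A => proj1_sig (constructive_indefinite_description _ (henkin_step G A)).

Let nth_formula (n : nat) : formula :=
  epsilon (inhabits fbot) (fun A => fcode A = n).

Lemma nth_formula_fcode A : nth_formula (fcode A) = A.
Proof.
  apply fcode_inj. unfold nth_formula.
  apply (epsilon_spec (inhabits fbot) (fun B => fcode B = fcode A)); eauto.
Qed.

Fixpoint stage (n : nat) : ctx :=
  match n with
  | O => exist _ G0 G0_consistent
  | S n => step (stage n) (nth_formula n)
  end.

Lemma stage_mono n m : n <= m -> incl (proj1_sig (stage n)) (proj1_sig (stage m)).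
Proof.
  induction 1; [apply incl_refl|].
  eapply incl_tran; [exact IHle|]. simpl; unfold step.
  now destruct (constructive_indefinite_description _ _) as [G' HG'].
Qed.

(** The deductive closure of the union of all stages: a complete consistent theory with
    witnesses. *)
Definition holds (A : formula) : Prop := exists n, derives T (proj1_sig (stage n)) A.

Lemma holds_ctx G A : derives T G A -> (forall B, In B G -> holds B) -> holds A.
Proof.
  intros HD HG.
  assert (H : exists n, forall B, In B G -> derives T (proj1_sig (stage n)) B).
  { clear HD. induction G as [|B G IH]; [exists 0; now intros|].
    destruct IH as [n Hn]; [intros C HC; apply HG; now right|].
    destruct (HG B) as [m Hm]; [now left|].
    exists (n + m). intros C [<-|HC].
    - eapply weakening; [exact Hm|apply stage_mono; lia].
    - eapply weakening; [now apply Hn|apply stage_mono; lia]. }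
  destruct H as [n Hn]. exists n.
  clear HG. revert A HD. induction G as [|B G IH]; intros A HD.
  - eapply weakening; [exact HD|]. now intros ? [].
  - eapply d_impE; [|apply Hn; now left].
    apply IH; [intros C HC; apply Hn; now right|]. now apply d_impI.
Qed.

Lemma holds_bot : ~ holds fbot.
Proof. intros [n Hn]. exact (proj2_sig (stage n) Hn). Qed.

Lemma holds_dec A :
  (In A (proj1_sig (stage (S (fcode A)))) \/ holds (fnot A)).
Proof.
  cbv zeta; cbn [stage]; unfold step.
  destruct (constructive_indefinite_description _ _) as [G' HG']; cbn [proj1_sig].
  destruct HG' as [Hi [Hd _]].
  rewrite nth_formula_fcode in Hd. destruct Hd; [now left|].
  right; eexists; eassumption.
Qed.

Lemma stage_num_witness B : let A := fnot (falln B) in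
  In A (proj1_sig (stage (S (fcode A)))) ->
  exists t, In (fnot (inst_num t B)) (proj1_sig (stage (S (fcode A)))).
Proof.
  cbv zeta; cbn [stage]; unfold step.
  destruct (constructive_indefinite_description _ _) as [G' HG']; cbn [proj1_sig].
  destruct HG' as [_ [_ [Hw _]]].
  rewrite nth_formula_fcode in Hw. now apply Hw.
Qed.

Lemma stage_set_witness B : let A := fnot (falls B) in
  In A (proj1_sig (stage (S (fcode A)))) ->
  exists Y, In (fnot (inst_set Y B)) (proj1_sig (stage (S (fcode A)))).
Proof.
  cbv zeta; cbn [stage]; unfold step.
  destruct (constructive_indefinite_description _ _) as [G' HG']; cbn [proj1_sig].
  destruct HG' as [_ [_ [_ Hw]]].
  rewrite nth_formula_fcode in Hw. now apply Hw.
Qed.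

Lemma holds_not A : holds (fnot A) <-> ~ holds A.
Proof.
  split.
  - intros Hn Ha. apply holds_bot.
    apply (@holds_ctx [fnot A; A]).
    + apply d_impE with (A := A); apply d_hyp; simpl; auto.
    + now intros B [<-|[<-|[]]].
  - intros HA. destruct (holds_dec A) as [H|H]; [|exact H].
    destruct HA. eexists; apply d_hyp, H.
Qed.

Lemma holds_imp A B : holds (fimp A B) <-> (holds A -> holds B).
Proof.
  split.
  - intros HAB HA. apply (@holds_ctx [fimp A B; A]).
    + apply d_impE with (A := A); apply d_hyp; simpl; auto.
    + now intros C [<-|[<-|[]]].
  - intros H. destruct (classic (holds A)) as [HA|HA].
    + apply (@holds_ctx [B]); [|intros C [<-|[]]; auto].
      apply d_impI, d_hyp; simpl; auto.
    + apply holds_not in HA. apply (@holds_ctx [fnot A]); [|now intros C [<-|[]]].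
      apply d_impI, d_raa. apply d_impE with (A := A); apply d_hyp; simpl; auto.
Qed.

Lemma holds_alln B : holds (falln B) <-> forall t, holds (inst_num t B).
Proof.
  split.
  - intros H t. apply (@holds_ctx [falln B]); [|now intros C [<-|[]]].
    apply d_allnE, d_hyp; simpl; auto.
  - intros H. apply NNPP; intros Hn.
    destruct (holds_dec (fnot (falln B))) as [Hin|Hnn].
    + apply stage_num_witness in Hin. destruct Hin as [t Ht].
      apply (holds_not (inst_num t B)); [|auto].
      eexists; apply d_hyp, Ht.
    + apply holds_not in Hnn. apply Hnn. now apply holds_not.
Qed.

Lemma holds_alls B : holds (falls B) <-> forall Y, holds (inst_set Y B).
Proof.
  split.
  - intros H t. apply (@holds_ctx [falls B]); [|now intros C [<-|[]]].
    apply d_allsE, d_hyp; simpl; auto.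
  - intros H. apply NNPP; intros Hn.
    destruct (holds_dec (fnot (falls B))) as [Hin|Hnn].
    + apply stage_set_witness in Hin. destruct Hin as [t Ht].
      apply (holds_not (inst_set t B)); [|auto].
      eexists; apply d_hyp, Ht.
    + apply holds_not in Hnn. apply Hnn. now apply holds_not.
Qed.

Lemma holds_eq_subst A s t :
  holds (feq s t) -> holds (inst_num s A) -> holds (inst_num t A).
Proof.
  intros H1 H2. apply (@holds_ctx [feq s t; inst_num s A]).
  - eapply d_eq_subst; apply d_hyp; simpl; auto.
  - now intros C [<-|[<-|[]]].
Qed.

Lemma holds_eq_refl t : holds (feq t t).
Proof. exists 0. apply d_eq_refl. Qed.

Let lift t := tsubst tshift t.

Lemma tsubst_lift s t : tsubst (scons s tvar) (lift t) = t.
Proof. unfold lift; rewrite tsubst_comp; simpl; apply tsubst_id. Qed.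

Lemma holds_eq_sym s t : holds (feq s t) -> holds (feq t s).
Proof.
  intros H. pose proof (@holds_eq_subst (feq (tvar 0) (lift s)) s t H) as H'.
  unfold inst_num in H'; simpl in H'; rewrite !tsubst_lift in H'.
  apply H', holds_eq_refl.
Qed.

Lemma holds_eq_trans s t u : holds (feq s t) -> holds (feq t u) -> holds (feq s u).
Proof.
  intros H1 H2. pose proof (@holds_eq_subst (feq (lift s) (tvar 0)) t u H2) as H'.
  unfold inst_num in H'; simpl in H'; rewrite !tsubst_lift in H'. auto.
Qed.

(** [F] is [f] applied to a hole, variable 0. Besides reflexivity the only equality rule is
    replacement in a formula, used here in [f s = F]. *)
Lemma holds_eq_cong (f : term -> term) (F : term) s t :
  (forall u, tsubst (scons u tvar) F = f u) ->
  holds (feq s t) -> holds (feq (f s) (f t)).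
Proof.
  intros HF H.
  pose proof (@holds_eq_subst (feq (lift (f s)) F) s t H) as H'.
  unfold inst_num in H'; simpl in H'; rewrite !tsubst_lift, !HF in H'.
  apply H', holds_eq_refl.
Qed.

Lemma holds_eq_cong2 (f : term -> term -> term) a b a' b' :
  (forall u v s, tsubst s (f u v) = f (tsubst s u) (tsubst s v)) ->
  holds (feq a a') -> holds (feq b b') -> holds (feq (f a b) (f a' b')).
Proof.
  intros Hf Ha Hb. eapply holds_eq_trans.
  - apply (@holds_eq_cong (fun u => f u b) (f (tvar 0) (lift b)) a a'); auto.
    intros u; rewrite Hf, tsubst_lift; reflexivity.
  - apply (@holds_eq_cong (fun u => f a' u) (f (lift a') (tvar 0)) b b'); auto.
    intros u; rewrite Hf, tsubst_lift; reflexivity.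
Qed.

(** [sat] reads equality as equality of the metatheory, so terms are divided by provable equality.
    Sets carry no equality in the language and remain mere variables. *)
Let eqclass (t u : term) : Prop := holds (feq t u).
Let carrier := {P : term -> Prop | exists t, P = eqclass t}.
Let cls (t : term) : carrier := exist _ (eqclass t) (ex_intro _ t eq_refl).
Let rep (d : carrier) : term :=
  proj1_sig (constructive_indefinite_description _ (proj2_sig d)).

Lemma cls_eq t u : cls t = cls u <-> holds (feq t u).
Proof.
  split.
  - intros E. apply (f_equal (@proj1_sig _ _)) in E; simpl in E.
    change (eqclass t u). rewrite E. apply holds_eq_refl.
  - intros H. apply eq_sig_hprop; [intros; apply proof_irrelevance|].
    simpl. apply functional_extensionality; intros v.
    apply propositional_extensionality.
    unfold eqclass; split; intros; eauto using holds_eq_trans, holds_eq_sym.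
Qed.

Lemma cls_rep d : cls (rep d) = d.
Proof.
  apply eq_sig_hprop; [intros; apply proof_irrelevance|].
  simpl; unfold rep.
  now destruct (constructive_indefinite_description _ _) as [t Ht].
Qed.

Lemma rep_cls t : holds (feq (rep (cls t)) t).
Proof. apply cls_eq, cls_rep. Qed.

Definition term_model : structure := {|
  num := carrier;
  set := nat;
  nzero := cls tzero;
  none := cls tone;
  nadd a b := cls (tplus (rep a) (rep b));
  nmul a b := cls (tmult (rep a) (rep b));
  nlt a b := holds (flt (rep a) (rep b));
  nmem a X := holds (fmem (rep a) X)
|}.

Lemma eval_term_model s t :
  eval term_model (fun n => cls (s n)) t = cls (tsubst s t).
Proof.
  induction t; simpl; auto.
  - rewrite IHt1, IHt2. apply cls_eq.
    apply holds_eq_cong2; auto using rep_cls.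
  - rewrite IHt1, IHt2. apply cls_eq.
    apply holds_eq_cong2; auto using rep_cls.
Qed.

Lemma holds_flt_cong a a' b b' : holds (feq a a') -> holds (feq b b') ->
  holds (flt a b) -> holds (flt a' b').
Proof.
  intros Ha Hb H.
  pose proof (@holds_eq_subst (flt (tvar 0) (lift b)) a a' Ha) as H1.
  pose proof (@holds_eq_subst (flt (lift a') (tvar 0)) b b' Hb) as H2.
  unfold inst_num in H1, H2; simpl in H1, H2; rewrite !tsubst_lift in H1, H2. auto.
Qed.

Lemma holds_fmem_cong a a' X : holds (feq a a') ->
  holds (fmem a X) -> holds (fmem a' X).
Proof.
  intros Ha. pose proof (@holds_eq_subst (fmem (tvar 0) X) a a' Ha) as H1.
  unfold inst_num in H1; simpl in H1. auto.
Qed.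

Lemma scons_cls t s : (fun n => cls (scons t s n)) = scons (cls t) (fun n => cls (s n)).
Proof. apply functional_extensionality; now intros [|n]. Qed.

(** Every element is the class of its representative, so quantifying over the model amounts to
    quantifying over terms, which [holds_alln] and [holds_alls] match with the theory. *)
Lemma truth_lemma A : forall s r,
  sat term_model (fun n => cls (s n)) r A <-> holds (subst s r A).
Proof.
  induction A; intros s r; cbn [sat subst]; rewrite ?eval_term_model.
  - split; [tauto|apply holds_bot].
  - apply cls_eq.
  - simpl; split; apply holds_flt_cong; auto using rep_cls, holds_eq_sym.
  - simpl; split; apply holds_fmem_cong; auto using rep_cls, holds_eq_sym.
  - now rewrite holds_imp, IHA1, IHA2.
  - rewrite holds_alln. split.
    + intros H t. rewrite inst_num_up, <- IHA, scons_cls. apply H.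
    + intros H d. rewrite <- (cls_rep d), <- scons_cls, IHA, <- inst_num_up. apply H.
  - rewrite holds_alls. split.
    + intros H t. rewrite inst_set_up, <- IHA. apply H.
    + intros H d. rewrite IHA, <- inst_set_up. apply H.
Qed.

Lemma term_model_models : models T term_model.
Proof.
  intros A HA rho sig.
  assert (E : rho = fun n => cls (rep (rho n))).
  { apply functional_extensionality; intros n; now rewrite cls_rep. }
  rewrite E. apply truth_lemma. exists 0. now apply d_axiom, T_subst.
Qed.

Lemma term_model_hyp A : In A G0 -> sat term_model (fun n => cls (tvar n)) (fun X => X) A.
Proof.
  intros HA. apply truth_lemma. rewrite subst_id. exists 0. now apply d_hyp.
Qed.

End Henkin.

Theorem completeness T A : subst_closed T ->
  (forall M, models T M -> forall rho sig, sat M rho sig A) -> proves T A.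
Proof.
  intros HT HA. apply NNPP; intros Hn.
  assert (HG : consistent T [fnot A]).
  { intros HD. apply Hn, d_raa, HD. }
  apply (@term_model_hyp T HT _ HG (fnot A) (or_introl eq_refl)).
  apply HA. now apply term_model_models.
Qed.

(** Only comprehension has parameters, and substitution turns an instance into the instance of the
    substituted formula; the other axioms are sentences. *)
Lemma ACA0_subst_closed : subst_closed ACA0.
Proof.
  intros A s r HA. destruct HA; try (cbn; constructor).
  change (subst s r (∃S ∀N (#0 ∈ 0 ⇔ shift_set A))%f)
    with (∃S ∀N (#0 ∈ 0 ⇔ subst (up_num s) (up_set r) (shift_set A)))%f.
  rewrite subst_shift_set. constructor. now apply arithmetical_subst.
Qed.

(** * Reification of predicates as formulas *)

Lemma sat_subst M A : forall rho sig s r,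
  sat M rho sig (subst s r A)
  <-> sat M (fun n => eval M rho (s n)) (fun X => sig (r X)) A.
Proof.
  assert (Ht : forall rho s t, eval M rho (tsubst s t) = eval M (fun n => eval M rho (s n)) t).
  { intros rho s t; induction t; simpl; congruence. }
  induction A; intros rho sig s r; cbn [sat subst]; rewrite ?Ht; try tauto.
  - now rewrite IHA1, IHA2.
  - assert (E : forall x, (fun n => eval M (scons x rho) (up_num s n))
                        = scons x (fun n => eval M rho (s n))).
    { intros x; apply functional_extensionality; intros [|n]; simpl; [reflexivity|].
      now rewrite Ht. }
    split; intros H x; specialize (H x); revert H; now rewrite IHA, E.
  - assert (E : forall x, (fun n => scons x sig (up_set r n))
                        = scons x (fun n => sig (r n))).
    { intros x; apply functional_extensionality; now intros [|n]. }
    split; intros H x; specialize (H x); revert H; now rewrite IHA, E.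
Qed.

Lemma sat_shift_set M rho sig X A :
  sat M rho (scons X sig) (shift_set A) <-> sat M rho sig A.
Proof. unfold shift_set; rewrite sat_subst; reflexivity. Qed.

(** Variables 0 and 1 stand for a number [e] and a value [a]; the formula spells out the projections
    that lead from [e] to entry [n] of the assignment it codes. It is given before any structure,
    because one formula must serve in all of them. *)
Fixpoint lookup_formula (n : nat) : formula :=
  match n with
  | O => ((∃N (#1 ≐ tpair #2 #0)) ∨ (#1 ≐ 0 ∧ ¬ ∃N ∃N (#2 ≐ tpair #1 #0)))%f
  | S n =>
      (∃N (((∃N (#2 ≐ tpair #0 #1)) ∨ (#0 ≐ 0 ∧ ¬ ∃N ∃N (#3 ≐ tpair #1 #0))) ∧
           subst (scons #0%t (scons #2%t (fun _ => tzero))) (fun X => X) (lookup_formula n)))%f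
  end.

Fixpoint val_formula (t : term) : formula :=
  match t with
  | tvar n => lookup_formula n
  | tzero => (#1 ≐ 0)%f
  | tone => (#1 ≐ 1)%f
  | tplus a b =>
      (∃N ∃N (subst (scons #2%t (scons #1%t (fun _ => tzero))) (fun X => X) (val_formula a) ∧
              subst (scons #2%t (scons #0%t (fun _ => tzero))) (fun X => X) (val_formula b) ∧
              #3 ≐ #1 + #0))%f
  | tmult a b =>
      (∃N ∃N (subst (scons #2%t (scons #1%t (fun _ => tzero))) (fun X => X) (val_formula a) ∧
              subst (scons #2%t (scons #0%t (fun _ => tzero))) (fun X => X) (val_formula b) ∧
              #3 ≐ #1 * #0))%f
  end.

Lemma arithmetical_val_formula t : arithmetical (val_formula t).
Proof.
  induction t as [n| | | |]; [induction n| | | |]; cbn [val_formula lookup_formula];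
    cbn [arithmetical fnot fand for_ fexn]; repeat split; auto using arithmetical_subst.
Qed.

Section Reify.
Variable M : structure.
Implicit Types (rho : nat -> num M) (sig : nat -> set M) (A B : formula) (P Q : Prop).

Lemma reify_imp rho sig A B P Q : (sat M rho sig A <-> P) -> (sat M rho sig B <-> Q) ->
  (sat M rho sig (fimp A B) <-> (P -> Q)).
Proof. simpl; tauto. Qed.

Lemma reify_not rho sig A P : (sat M rho sig A <-> P) -> (sat M rho sig (fnot A) <-> ~ P).
Proof. simpl; tauto. Qed.

Lemma reify_and rho sig A B P Q : (sat M rho sig A <-> P) -> (sat M rho sig B <-> Q) ->
  (sat M rho sig (fand A B) <-> P /\ Q).
Proof. simpl; tauto. Qed.

Lemma reify_or rho sig A B P Q : (sat M rho sig A <-> P) -> (sat M rho sig B <-> Q) ->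
  (sat M rho sig (for_ A B) <-> P \/ Q).
Proof. simpl; tauto. Qed.

Lemma reify_iff rho sig A B P Q : (sat M rho sig A <-> P) -> (sat M rho sig B <-> Q) ->
  (sat M rho sig (fiff A B) <-> (P <-> Q)).
Proof. simpl; tauto. Qed.

Lemma reify_all rho sig A (P : num M -> Prop) :
  (forall x, sat M (scons x rho) sig A <-> P x) ->
  (sat M rho sig (falln A) <-> forall x, P x).
Proof. simpl; intros H; split; intros; apply H; auto. Qed.

Lemma reify_ex rho sig A (P : num M -> Prop) :
  (forall x, sat M (scons x rho) sig A <-> P x) ->
  (sat M rho sig (fexn A) <-> exists x, P x).
Proof.
  simpl; intros H; split.
  - intros HA; apply NNPP; intros Hn; apply HA; intros x Hx; apply Hn.
    exists x; now apply H.
  - intros [x Hx] HA; apply (HA x); now apply H.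
Qed.

Lemma reify_alls rho sig A (P : set M -> Prop) :
  (forall x, sat M rho (scons x sig) A <-> P x) ->
  (sat M rho sig (falls A) <-> forall x, P x).
Proof. simpl; intros H; split; intros; apply H; auto. Qed.

Lemma reify_exs rho sig A (P : set M -> Prop) :
  (forall x, sat M rho (scons x sig) A <-> P x) ->
  (sat M rho sig (fexs A) <-> exists x, P x).
Proof.
  simpl; intros H; split.
  - intros HA; apply NNPP; intros Hn; apply HA; intros x Hx; apply Hn.
    exists x; now apply H.
  - intros [x Hx] HA; apply (HA x); now apply H.
Qed.

Lemma reify_eq rho sig s t a b : eval M rho s = a -> eval M rho t = b ->
  (sat M rho sig (feq s t) <-> a = b).
Proof. simpl; now intros -> ->. Qed.

Lemma reify_lt rho sig s t a b : eval M rho s = a -> eval M rho t = b ->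
  (sat M rho sig (flt s t) <-> nlt M a b).
Proof. simpl; now intros -> ->. Qed.

Lemma reify_mem rho sig s X a V : eval M rho s = a -> sig X = V ->
  (sat M rho sig (fmem s X) <-> nmem M a V).
Proof. simpl; now intros -> ->. Qed.

Lemma reify_bot rho sig : sat M rho sig fbot <-> False.
Proof. simpl; tauto. Qed.

Lemma reify_term_zero rho : eval M rho tzero = nzero M.
Proof. reflexivity. Qed.

Lemma reify_term_one rho : eval M rho tone = none M.
Proof. reflexivity. Qed.

Lemma reify_term_add rho s t a b : eval M rho s = a -> eval M rho t = b ->
  eval M rho (tplus s t) = nadd M a b.
Proof. simpl; now intros -> ->. Qed.

Lemma reify_term_mul rho s t a b : eval M rho s = a -> eval M rho t = b ->
  eval M rho (tmult s t) = nmul M a b.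
Proof. simpl; now intros -> ->. Qed.

Lemma reify_term_var rho n a : rho n = a -> eval M rho (tvar n) = a.
Proof. auto. Qed.

Lemma scons_here T (a : T) f : scons a f 0 = a.
Proof. reflexivity. Qed.

Lemma scons_there T (a b : T) f n : f n = a -> scons b f (S n) = a.
Proof. auto. Qed.

End Reify.

Ltac reify_var :=
  lazymatch goal with
  | |- scons ?x ?f ?n = ?v =>
      first [ constr_eq x v; exact (scons_here x f)
            | eapply scons_there; reify_var ]
  | |- ?f ?n = ?v => is_evar f;
      let g := open_constr:(scons v _) in unify f g; exact (scons_here v _)
  end.

Ltac reify_term_hook := fail.
Ltac reify_term :=
  lazymatch goal with
  | |- eval ?M ?rho ?t = ?v =>
      lazymatch v with
      | nzero M => exact (reify_term_zero M rho)
      | none M => exact (reify_term_one M rho)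
      | nadd M _ _ => eapply reify_term_add; [reify_term|reify_term]
      | nmul M _ _ => eapply reify_term_mul; [reify_term|reify_term]
      | _ => first [ eapply reify_term_var; reify_var
                   | reify_term_hook
                   | let h := head_of v in unfold h; cbv beta; reify_term ]
      end
  end
with head_of v :=
  lazymatch v with
  | ?f _ => head_of f
  | _ => v
  end.

(** [reify] proves [sat M rho sig ?A <-> P] by building the formula [?A].  If [rho] or
    [sig] ends in an existential variable, parameters of [P] that do not occur in the
    assignment are appended to it. *)
Ltac reify_hook := fail.
Ltac reify :=
  lazymatch goal with
  | |- sat ?M ?rho ?sig ?A <-> ?P =>
      lazymatch P with
      | False => exact (reify_bot M rho sig)
      | ?a = ?b => eapply reify_eq; [reify_term|reify_term]
      | nlt _ _ _ => eapply reify_lt; [reify_term|reify_term]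
      | nmem _ _ _ => eapply reify_mem; [reify_term|reify_var]
      | _ /\ _ => eapply reify_and; [reify|reify]
      | _ \/ _ => eapply reify_or; [reify|reify]
      | _ <-> _ => eapply reify_iff; [reify|reify]
      | ~ _ => eapply reify_not; reify
      | (?a -> ?b) =>
          lazymatch type of a with
          | Prop => eapply reify_imp; [reify|reify]
          end
      | (forall x : num _, _) =>
          eapply reify_all; let y := fresh x in intros y; cbv beta; reify
      | (forall x : set _, _) =>
          eapply reify_alls; let y := fresh x in intros y; cbv beta; reify
      | (exists x : num _, _) =>
          eapply reify_ex; let y := fresh x in intros y; cbv beta; reify
      | (exists x : set _, _) =>
          eapply reify_exs; let y := fresh x in intros y; cbv beta; reify
      | _ => first [ reify_hook
                   | let h := head_of P in unfold h; cbv beta; reify ]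
      end
  end.

Ltac prove_arithmetical :=
  cbn [arithmetical fnot fand for_ fiff fexn];
  repeat split; auto using arithmetical_subst, arithmetical_val_formula.

Lemma comprehension_formula M A rho sig : models ACA0 M -> arithmetical A ->
  exists X, forall n, nmem M n X <-> sat M (scons n rho) sig A.
Proof.
  intros HM HA. pose proof (HM _ (ax_comprehension A HA) rho sig) as H.
  revert H. apply reify_exs; intros X. apply reify_all; intros n.
  apply reify_iff; [reflexivity|]. apply sat_shift_set.
Qed.

(** Meant to be applied with [A], [rho] and [sig] left open: [reify] builds the formula from [P] and
    collects its parameters, and [comprehend] fills the rest of the assignments arbitrarily. *)
Lemma comprehension M (P : num M -> Prop) A rho sig : models ACA0 M ->
  (forall n, sat M (scons n rho) sig A <-> P n) -> arithmetical A ->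
  exists X, forall n, nmem M n X <-> P n.
Proof.
  intros HM HP HA. destruct (@comprehension_formula M A rho sig HM HA) as [X HX].
  exists X; intros n; now rewrite HX, HP.
Qed.

Ltac comprehend :=
  cbv beta;
  lazymatch goal with
  | HM : models ACA0 ?M, S0 : set ?M |- _ =>
      unshelve (eapply (@comprehension M); [exact HM|intros ?; reify|prove_arithmetical]);
      first [exact (fun _ => nzero M)|exact (fun _ => S0)]
  end.

(** * Elementary arithmetic in a model of ACA0 *)

Section Model.
Variable M : structure.
Hypothesis M_ACA0 : models ACA0 M.
(* A structure with no sets at all vacuously satisfies every formula that is
   evaluated under a set assignment. *)
Variable S0 : set M.

Declare Scope num_scope.
Delimit Scope num_scope with num.
Local Open Scope num_scope.
Local Notation "0" := (nzero M) : num_scope.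
Local Notation "1" := (none M) : num_scope.
Local Notation "x + y" := (nadd M x y) : num_scope.
Local Notation "x * y" := (nmul M x y) : num_scope.
Local Notation "x < y" := (nlt M x y) : num_scope.
Local Notation "x <= y" := (nlt M x (y + 1)) : num_scope.
Local Notation "x ∈ X" := (nmem M x X) (at level 70) : num_scope.
Local Notation N := (num M).

Let rho0 : nat -> N := fun _ => 0.
Let sig0 : nat -> set M := fun _ => S0.

(** [M] may be nonstandard, so induction is available only for predicates realised by its sets; each
    use of [ind] below therefore rests on an instance of comprehension. *)
Lemma num_ind (P : N -> Prop) : (exists X, forall n, n ∈ X <-> P n) ->
  P 0 -> (forall x, P x -> P (x + 1)) -> forall x, P x.
Proof.
  intros [X HX] H0 HS x. apply HX.
  pose proof (M_ACA0 ax_induction rho0 sig0 X) as H; cbn in H.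
  apply H. intros Hn; apply Hn; [now apply HX|].
  intros y Hy; apply HX, HS, HX, Hy.
Qed.

Lemma succ_neq0 x : x + 1 <> 0.
Proof. exact (M_ACA0 ax_succ_neq0 rho0 sig0 x). Qed.

Lemma succ_inj x y : x + 1 = y + 1 -> x = y.
Proof. exact (M_ACA0 ax_succ_inj rho0 sig0 x y). Qed.

Lemma add_0_r x : x + 0 = x.
Proof. exact (M_ACA0 ax_plus0 rho0 sig0 x). Qed.

Lemma add_succ_r x y : x + (y + 1) = (x + y) + 1.
Proof. exact (M_ACA0 ax_plusS rho0 sig0 x y). Qed.

Lemma mul_0_r x : x * 0 = 0.
Proof. exact (M_ACA0 ax_mult0 rho0 sig0 x). Qed.

Lemma mul_succ_r x y : x * (y + 1) = x * y + x.
Proof. exact (M_ACA0 ax_multS rho0 sig0 x y). Qed.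

Lemma lt_0_r x : ~ x < 0.
Proof. exact (M_ACA0 ax_lt0 rho0 sig0 x). Qed.

Lemma lt_succ_r x y : x < y + 1 <-> x < y \/ x = y.
Proof.
  pose proof (M_ACA0 ax_ltS rho0 sig0 x y) as H; revert H.
  apply reify_iff; [reflexivity|]. apply reify_or; reflexivity.
Qed.

Ltac ind :=
  lazymatch goal with
  | |- forall x, @?P x => refine (@num_ind P _ _ _); [comprehend| |]; cbv beta
  end.

Lemma add_assoc x y z : x + (y + z) = x + y + z.
Proof.
  revert z; ind.
  - now rewrite !add_0_r.
  - intros z IH. now rewrite !add_succ_r, IH.
Qed.

Lemma add_0_l x : 0 + x = x.
Proof.
  revert x; ind.
  - apply add_0_r.
  - intros x IH; now rewrite add_succ_r, IH.
Qed.

Lemma add_1_comm x : x + 1 = 1 + x.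
Proof.
  revert x; ind.
  - now rewrite add_0_r, add_0_l.
  - intros x IH. now rewrite add_succ_r, <- IH.
Qed.

Lemma add_comm x y : x + y = y + x.
Proof.
  revert y; ind.
  - now rewrite add_0_r, add_0_l.
  - intros y IH. now rewrite add_succ_r, IH, <- !add_assoc, (add_1_comm x).
Qed.

Lemma mul_add_distr_l x y z : x * (y + z) = x * y + x * z.
Proof.
  revert z; ind.
  - now rewrite mul_0_r, !add_0_r.
  - intros z IH. now rewrite add_succ_r, !mul_succ_r, IH, add_assoc.
Qed.

Lemma mul_0_l x : 0 * x = 0.
Proof.
  revert x; ind.
  - apply mul_0_r.
  - intros x IH. now rewrite mul_succ_r, IH, add_0_r.
Qed.

Lemma mul_succ_l x y : (x + 1) * y = x * y + y.
Proof.
  revert y; ind.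
  - now rewrite !mul_0_r, add_0_r.
  - intros y IH. rewrite !mul_succ_r, IH, <- !add_assoc. f_equal.
    now rewrite !add_assoc, (add_comm y x).
Qed.

Lemma mul_comm x y : x * y = y * x.
Proof.
  revert y; ind.
  - now rewrite mul_0_l, mul_0_r.
  - intros y IH. now rewrite mul_succ_r, mul_succ_l, IH.
Qed.

Lemma mul_assoc x y z : x * (y * z) = x * y * z.
Proof.
  revert z; ind.
  - now rewrite !mul_0_r.
  - intros z IH. now rewrite !mul_succ_r, mul_add_distr_l, IH.
Qed.

Lemma mul_1_l x : 1 * x = x.
Proof.
  rewrite <- (add_0_l 1), mul_succ_l, mul_0_l. apply add_0_l.
Qed.

Lemma num_semi_ring : semi_ring_theory 0 1 (nadd M) (nmul M) eq.
Proof.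
  constructor; auto using add_0_l, add_comm, add_assoc, mul_1_l, mul_0_l,
    mul_comm, mul_assoc.
  intros x y z. now rewrite !(mul_comm _ z), mul_add_distr_l.
Qed.

Add Ring num_ring : num_semi_ring.

Lemma add_cancel_r x y z : x + z = y + z -> x = y.
Proof.
  revert z; ind.
  - now rewrite !add_0_r.
  - intros z IH. rewrite !add_succ_r. intros H; apply IH, succ_inj, H.
Qed.

Lemma zero_or_succ x : x = 0 \/ exists y, x = y + 1.
Proof. revert x; ind; eauto. Qed.

Lemma lt_iff_add x y : x < y <-> exists z, y = x + z + 1.
Proof.
  revert x y.
  assert (H : forall y x, x < y <-> exists z, y = x + z + 1); [|auto].
  ind.
  - intros x; split; [intros H; now apply lt_0_r in H|].
    intros [z Hz]; symmetry in Hz; now apply succ_neq0 in Hz.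
  - intros y IH x. rewrite lt_succ_r, IH. split.
    + intros [[z ->]| ->]; [exists (z + 1); ring|exists 0; ring].
    + intros [z Hz]. apply succ_inj in Hz. subst y.
      destruct (zero_or_succ z) as [->|[w ->]]; [right; ring|].
      left; exists w; ring.
Qed.

Lemma le_iff_add x y : x <= y <-> exists z, y = x + z.
Proof.
  rewrite lt_iff_add. split; intros [z Hz]; exists z; [now apply succ_inj|].
  now rewrite Hz.
Qed.

Lemma add_eq_0 x y : x + y = 0 -> x = 0.
Proof.
  destruct (zero_or_succ x) as [->|[z ->]]; [auto|].
  intros H. destruct (@succ_neq0 (z + y)). rewrite <- H; ring.
Qed.

Lemma lt_irrefl x : ~ x < x.
Proof.
  rewrite lt_iff_add; intros [z Hz]. apply (@succ_neq0 z).
  apply add_cancel_r with x. rewrite Hz at 2. ring.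
Qed.

Lemma lt_trans x y z : x < y -> y < z -> x < z.
Proof.
  rewrite !lt_iff_add. intros [u ->] [v ->]. exists (u + 1 + v); ring.
Qed.

Lemma le_refl x : x <= x.
Proof. apply lt_succ_r; auto. Qed.

Lemma lt_le x y : x < y -> x <= y.
Proof. intros; apply lt_succ_r; auto. Qed.

Lemma lt_le_trans x y z : x < y -> y <= z -> x < z.
Proof. intros H. rewrite lt_succ_r. intros [H1|<-]; eauto using lt_trans. Qed.

Lemma le_lt_trans x y z : x <= y -> y < z -> x < z.
Proof. rewrite lt_succ_r. intros [H1| ->]; eauto using lt_trans. Qed.

Lemma le_trans x y z : x <= y -> y <= z -> x <= z.
Proof. rewrite (lt_succ_r y z). intros H [H1|<-]; eauto using le_lt_trans, lt_le. Qed.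

Lemma le_0 x : 0 <= x.
Proof. apply le_iff_add. exists x; ring. Qed.

Lemma lt_total x y : x < y \/ x = y \/ y < x.
Proof.
  revert x; ind.
  - pose proof (le_0 y) as H. apply lt_succ_r in H. tauto.
  - intros x [H|[->|H]].
    + apply lt_iff_add in H. destruct H as [z ->].
      destruct (zero_or_succ z) as [->|[w ->]].
      * right; left; ring.
      * left. apply lt_iff_add. exists w; ring.
    + right; right; apply le_refl.
    + right; right; now apply lt_le.
Qed.

Lemma lt_not_le x y : x < y -> ~ y <= x.
Proof. intros H1 H2. apply (lt_irrefl x); eauto using lt_le_trans. Qed.

Lemma le_or_lt x y : x <= y \/ y < x.
Proof. rewrite lt_succ_r. destruct (lt_total x y) as [|[|]]; auto. Qed.

Lemma le_add_r x y : x <= x + y.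
Proof. apply le_iff_add; eauto. Qed.

Lemma le_add_l x y : x <= y + x.
Proof. apply le_iff_add; exists y; ring. Qed.

Lemma lt_neq x y : x < y -> x <> y.
Proof. intros H ->. exact (lt_irrefl _ H). Qed.

(** * Pairs, Gödel's beta function and codes of finite sets *)

Definition pair (x y : N) : N := (x + y) * (x + y) + x.

Lemma pair_le_l x y : x <= pair x y.
Proof. apply le_add_l. Qed.

Lemma pair_lt x y x' y' : x + y < x' + y' -> pair x y < pair x' y'.
Proof.
  intros H. apply lt_iff_add in H. destruct H as [z Hz].
  unfold pair. rewrite Hz. apply lt_iff_add.
  (* With [s = x + y] the codes differ by [(z + 1) * (2s + z + 1) + x' - x]; writing [2s - x] as
     [s + y] avoids subtraction. *)
  exists (y + (1 + 1) * (x + y) * z + (x + y) + z * z + (1 + 1) * z + x'). ring.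
Qed.

Lemma pair_inj x y x' y' : pair x y = pair x' y' -> x = x' /\ y = y'.
Proof.
  intros H. destruct (lt_total (x + y) (x' + y')) as [Hl|[He|Hl]].
  - now apply pair_lt, lt_neq in Hl.
  - assert (Ex : x = x').
    { unfold pair in H. rewrite <- He in H. apply add_cancel_r with ((x + y) * (x + y)).
      now rewrite !(add_comm _ ((x + y) * (x + y))). }
    split; [exact Ex|]. subst x'. apply add_cancel_r with x.
    now rewrite !(add_comm _ x).
  - apply pair_lt, lt_neq in Hl. now destruct Hl.
Qed.

Definition dvd (d x : N) : Prop := exists k, x = d * k.

(** Without subtraction there are two cases: either [v <= u] and [b] is [d] times their difference,
    or [u < v] forces [b = 0]. *)
Lemma dvd_add_cancel d u v b : d * u = d * v + b -> dvd d b.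
Proof.
  intros H. destruct (le_or_lt v u) as [Hl|Hl].
  - apply le_iff_add in Hl. destruct Hl as [w ->]. exists w.
    apply add_cancel_r with (d * v). rewrite add_comm, <- H. ring.
  - apply lt_iff_add in Hl. destruct Hl as [w ->]. exists 0.
    transitivity 0; [|ring].
    apply add_eq_0 with (d * (w + 1)).
    apply add_cancel_r with (d * u). rewrite add_0_l. rewrite H at 2. ring.
Qed.

(** A substitute for the factorial, whose definition would need the coding that is being prepared.
    That [m] is not 0 keeps the moduli different from 1. *)
Lemma common_multiple n : exists m, m <> 0 /\ forall k, k < n -> dvd (k + 1) m.
Proof.
  revert n; ind.
  - exists 1. split; [|intros k Hk; now apply lt_0_r in Hk].
    rewrite <- (add_0_l 1). apply succ_neq0.
  - intros n [m [Hm Hd]]. exists (m * (n + 1)). split.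
    + intros H. apply Hm. rewrite mul_succ_r in H.
      apply add_eq_0 with (m * n). rewrite <- H; ring.
    + intros k Hk. apply lt_succ_r in Hk. destruct Hk as [Hk| ->].
      * destruct (Hd k Hk) as [q ->]. exists (q * (n + 1)); ring.
      * exists m; ring.
Qed.

(** Gödel's beta function: the numbers [modulus m x] are pairwise coprime for
    [x < n] as soon as all of [1, ..., n] divide [m]. *)
Definition modulus (m x : N) : N := 1 + (x + 1) * m.

Lemma modulus_coprime n m b x y :
  (forall k, k < n -> dvd (k + 1) m) -> x < n -> y < n -> x <> y ->
  dvd (modulus m x) (b * modulus m y) -> dvd (modulus m x) b.
Proof.
  intros Hm Hx Hy Hxy [t Ht].
  assert (Hq : forall j, j < n -> exists q, m = (j + 1) * q) by exact Hm.
  (* [modulus m y - modulus m x] is, up to sign, [(j + 1) * m] with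
     [j + 1 = |y - x|] a divisor of [m]; and [(x + 1) * m] is [-1] modulo
     [modulus m x]. *)
  destruct (lt_total x y) as [H|[H|H]]; [|now destruct Hxy|];
    apply lt_iff_add in H; destruct H as [j Hj].
  - destruct (Hq j) as [q Eq].
    { apply le_lt_trans with y; [|exact Hy]. apply le_iff_add. exists (x + 1).
      rewrite Hj; ring. }
    (* [X] is chosen so that [(j + 1) * m * X] is the square of [a], which is 1 modulo [1 + a];
       multiplied by [b], it leaves [b]. *)
    set (X := (x + 1) * (x + 1) * q). set (a := (x + 1) * m).
    apply (@dvd_add_cancel _ (t * X + b) (b * X + b * a)).
    assert (E : b * modulus m y * X = modulus m x * t * X) by now rewrite Ht.
    transitivity (modulus m x * t * X + b * modulus m x); [ring|]. rewrite <- E.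
    transitivity (b * modulus m x * X + b * ((j + 1) * q) * (m * (x + 1) * (x + 1)) + b * modulus m x).
    + unfold X, modulus; rewrite Hj; ring.
    + rewrite <- Eq. unfold a, modulus. ring.
  - destruct (Hq j) as [q Eq].
    { apply le_lt_trans with x; [|exact Hx]. apply le_iff_add. exists (y + 1).
      rewrite Hj; ring. }
    set (X := (x + 1) * (x + 1) * q). set (a := (x + 1) * m).
    apply (@dvd_add_cancel _ (b * X + b) (t * X + b * a)).
    transitivity (b * modulus m y * X + b * ((j + 1) * q) * (m * (x + 1) * (x + 1)) + b * modulus m x).
    + unfold X, modulus; rewrite Hj; ring.
    + rewrite <- Eq, Ht. unfold a, modulus. ring.
Qed.

(** The component [n] makes every coded set bounded, whatever else divides [b]. A number of another
    form codes the empty set, and a set has many codes. *)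
Definition elem (x c : N) : Prop :=
  exists n b m, c = pair n (pair b m) /\ x < n /\ dvd (modulus m x) b.

Definition code_of (c : N) (X : set M) (n : N) : Prop :=
  forall x, elem x c <-> x ∈ X /\ x < n.

(** [b] is the product of the moduli of the elements, built up one candidate at a time; coprimality
    keeps a new factor from bringing in other elements. *)
Lemma code_exists X n : exists c, code_of c X n.
Proof.
  destruct (common_multiple n) as [m [Hm Hd]].
  assert (H : forall k, exists b, forall x, x < n ->
    (dvd (modulus m x) b <-> x ∈ X /\ x < k)).
  { ind.
    - exists 1. intros x Hx. split; [|intros [_ H]; now apply lt_0_r in H].
      intros [t Ht]. exfalso. apply Hm.
      destruct (zero_or_succ t) as [->|[u ->]].
      + rewrite mul_0_r in Ht. destruct (@succ_neq0 0). now rewrite add_0_l.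
      + apply add_eq_0 with (modulus m x * u + x * m).
        apply succ_inj. rewrite add_0_l. rewrite Ht at 2. unfold modulus; ring.
    - intros k [b Hb].
      destruct (le_or_lt n k) as [Hk|Hk].
      { exists b. intros x Hx. rewrite (Hb x Hx).
        assert (x < k) by eauto using lt_le_trans.
        assert (x < k + 1) by now apply lt_le. tauto. }
      destruct (classic (k ∈ X)) as [HkX|HkX].
      + exists (b * modulus m k). intros x Hx. destruct (classic (x = k)) as [->|Hn].
        * split; [intros _; split; [exact HkX|apply le_refl]|].
          intros _; exists b; ring.
        * rewrite (lt_succ_r x k). specialize (Hb x Hx). split.
          -- intros H. apply modulus_coprime with (n := n) in H; auto. tauto.
          -- intros [H1 [H2|H2]]; [|tauto].
             destruct (proj2 Hb (conj H1 H2)) as [t ->]. exists (t * modulus m k); ring.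
      + exists b. intros x Hx. rewrite (Hb x Hx), lt_succ_r. split; [tauto|].
        intros [H1 [H2| ->]]; tauto. }
  destruct (H n) as [b Hb]. exists (pair n (pair b m)). intros x. split.
  - intros (n' & b' & m' & E & Hx & Hdvd). apply pair_inj in E. destruct E as [<- E].
    apply pair_inj in E. destruct E as [<- <-]. now apply Hb.
  - intros [H1 H2]. exists n, b, m. repeat split; auto. now apply Hb.
Qed.

Lemma elem_bounded c : exists n, forall x, elem x c -> x < n.
Proof.
  destruct (classic (exists n b m, c = pair n (pair b m))) as [(n & b & m & E)|Hn].
  - exists n. intros x (n' & b' & m' & E' & Hx & _). subst c.
    now apply pair_inj in E' as [<- _].
  - exists 0. intros x (n' & b' & m' & E' & _). destruct Hn; eauto.
Qed.

(** The approximations [good c n] agree where both are defined, so comprehension yields their union.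
    As finite sets have many codes, the question is whether [F] accepts some code of the part below
    [n], which depends on that part alone. *)
Lemma recursion (F : set M) :
  exists V, forall n, n ∈ V <-> exists c, code_of c V n /\ pair c n ∈ F.
Proof.
  set (val := fun c x => exists d, (forall y, elem y d <-> elem y c /\ y < x) /\ pair d x ∈ F).
  set (good := fun c n => forall x, elem x c <-> x < n /\ val c x).
  assert (good_unique : forall c c' n n', good c n -> good c' n' ->
    forall y, forall x, x < y -> x < n -> x < n' -> (elem x c <-> elem x c')).
  { intros c c' n n' Hc Hc'. ind.
    - intros x Hx; now apply lt_0_r in Hx.
    - intros y IH x Hx Hn Hn'. apply lt_succ_r in Hx. destruct Hx as [Hx| ->]; [now apply IH|].
      rewrite (Hc y), (Hc' y).
      assert (E : forall d, (forall z, elem z d <-> elem z c /\ z < y)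
                        <-> (forall z, elem z d <-> elem z c' /\ z < y)).
      { intros d. split; intros H z; rewrite (H z); split; intros [H1 H2]; split; auto;
          apply (IH z); eauto using lt_trans. }
      unfold val. split; intros [_ [d [Hd HF]]]; (split; [auto|]);
        exists d; split; auto; now apply E. }
  assert (good_exists : forall n, exists c, good c n).
  { ind.
    - destruct (code_exists S0 0) as [c Hc]. exists c. intros x. rewrite (Hc x).
      split; intros [H1 H2]; [now apply lt_0_r in H2|now apply lt_0_r in H1].
    - intros n [c Hc].
      assert (HX : exists X, forall x, x ∈ X <-> elem x c \/ (x = n /\ val c n)) by comprehend.
      destruct HX as [X HX]. destruct (code_exists X (n + 1)) as [c' Hc'].
      assert (E : forall x, x < n -> (elem x c' <-> elem x c)).
      { intros x Hx. rewrite (Hc' x), HX. split.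
        - intros [[H|[-> _]] _]; [auto|]. now apply lt_irrefl in Hx.
        - intros H; split; auto. now apply lt_le. }
      exists c'. intros x.
      assert (EV : x <= n -> (val c x <-> val c' x)).
      { intros Hx. unfold val. split; intros (d & Hd & HF); exists d; (split; [|exact HF]);
          intros y; rewrite (Hd y); split; intros [H1 H2]; split; auto;
          apply (E y); eauto using lt_le_trans. }
      split.
      + intros H. assert (Hx : x <= n) by now apply Hc'. split; [exact Hx|].
        apply EV; [exact Hx|].
        apply lt_succ_r in Hx. destruct Hx as [Hx| ->].
        * apply Hc. now apply E.
        * apply Hc' in H. destruct H as [H _]. apply HX in H.
          destruct H as [H|[_ H]]; [|exact H]. now apply Hc in H as [H _]; apply lt_irrefl in H.
      + intros [Hx Hv]. apply EV in Hv; [|exact Hx].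
        apply Hc'; split; [|exact Hx]. apply HX.
        apply lt_succ_r in Hx. destruct Hx as [Hx| ->]; [left; now apply Hc|auto]. }
  assert (HV : exists V, forall x, x ∈ V <-> exists c, good c (x + 1) /\ elem x c) by comprehend.
  destruct HV as [V HV]. exists V.
  assert (init : forall c n, good c n -> code_of c V n).
  { intros c n Hc x. rewrite HV. split.
    - intros H. assert (Hx : x < n) by now apply Hc. split; [|exact Hx].
      destruct (good_exists (x + 1)) as [c' Hc']. exists c'. split; [exact Hc'|].
      apply (@good_unique c c' n (x + 1) Hc Hc' (x + 1)); auto using le_refl.
    - intros [(c' & Hc' & H) Hx].
      apply (@good_unique c c' n (x + 1) Hc Hc' (x + 1)); auto using le_refl. }
  intros n. destruct (good_exists (n + 1)) as [c Hc].
  assert (En : n ∈ V <-> val c n).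
  { pose proof (init _ _ Hc n) as H1. pose proof (Hc n) as H2.
    pose proof (le_refl n). tauto. }
  rewrite En. unfold val.
  split; intros (d & Hd & HF); exists d; (split; [|exact HF]); intros x;
    rewrite (Hd x), (init _ _ Hc x); split; intros H; repeat split; try tauto.
  all: apply lt_le; tauto.
Qed.

(** * Sets of nodes closed under almost all children, and branches *)

Definition node (R : N -> N -> N -> Prop) (c : N) : Prop :=
  exists s, forall v w, elem v c -> elem w c -> v < w -> R s v w.

(** [d] is fixed only up to membership: all codes of the enlarged set count as children. *)
Definition child (c m d : N) : Prop :=
  exists w, m <= w /\ (forall x, elem x c -> x < w) /\
    forall x, elem x d <-> elem x c \/ x = w.

Section Tree.
Variable K : set M.
(** The condition is given by a set of the structure, not by a predicate, so that comprehension
    applies to formulas that mention it. *)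
Definition ok (s v w : N) : Prop := pair s (pair v w) ∈ K.
Hypothesis ok_ext : forall s s' v w,
  (forall q, q < w -> (elem q s <-> elem q s')) -> ok s v w -> ok s' v w.
Hypothesis ok_mono : forall s v w w', w <= w' -> ok s v w -> ok s v w'.
Hypothesis ok_anti : forall s v v' w, v' <= v -> ok s v w -> ok s v' w.

(** By [ok_ext] all codes of [V] below [w] give the same answer. *)
Definition ok_set (V : set M) (v w : N) : Prop :=
  forall s, code_of s V w -> ok s v w.

Lemma ok_code V s n v w : code_of s V n -> w <= n ->
  (ok s v w <-> ok_set V v w).
Proof.
  intros Hs Hw.
  assert (E : forall t, code_of t V w -> forall q, q < w -> (elem q s <-> elem q t)).
  { intros t Ht q Hq. rewrite (Hs q), (Ht q).
    assert (q < n) by eauto using lt_le_trans. tauto. }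
  split.
  - intros H t Ht. apply ok_ext with s; auto.
  - intros H. destruct (code_exists V w) as [t Ht].
    apply ok_ext with t; auto. intros q Hq. symmetry; auto.
Qed.

Lemma ok_set_mono V v w w' : w <= w' -> ok_set V v w -> ok_set V v w'.
Proof.
  intros Hw H s Hs. apply ok_mono with w; [exact Hw|].
  now apply (@ok_code V s w' v w Hs Hw).
Qed.

Lemma ok_set_uniform V : (forall v, exists w, ok_set V v w) ->
  forall n, exists w, forall v, v < n -> ok_set V v w.
Proof.
  intros HV. ind.
  - exists 0. intros v Hv; now apply lt_0_r in Hv.
  - intros n [w Hw]. destruct (HV n) as [w' Hw']. exists (w + w').
    intros v Hv. apply lt_succ_r in Hv. destruct Hv as [Hv| ->].
    + apply ok_set_mono with w; auto using le_add_r.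
    + apply ok_set_mono with w'; auto using le_add_l.
Qed.

(** By [ok_set_uniform] one stage serves all elements of [c] at once, and so does every later one.
    The last clause, removal of the largest element, is what will make the complement open. *)
Lemma branch_clopen V : (forall v, exists w, ok_set V v w) ->
  exists S, (exists c, c ∈ S) /\ (forall c, c ∈ S -> node ok c) /\
    (forall c, c ∈ S -> exists m, forall d, child c m d -> d ∈ S) /\
    (forall c m d, child c m d -> d ∈ S -> c ∈ S).
Proof.
  intros HV.
  assert (HS : exists S, forall c, c ∈ S <->
    forall v w, elem v c -> elem w c -> v < w -> ok_set V v w) by comprehend.
  destruct HS as [S HS]. exists S. repeat split.
  - destruct (code_exists S0 0) as [c Hc]. exists c. apply HS. intros v w H.
    apply Hc in H. destruct H as [_ H]. now apply lt_0_r in H.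
  - intros c Hc. destruct (elem_bounded c) as [n Hn], (code_exists V n) as [s Hs].
    exists s. intros v w Hv Hw Hvw. apply (@ok_code V s n v w Hs); [now apply lt_le, Hn|].
    apply HS with c; auto.
  - intros c Hc. destruct (elem_bounded c) as [n Hn].
    destruct (ok_set_uniform HV n) as [m Hm]. exists m.
    intros d (w & Hmw & Hw & Hd). apply HS.
    intros u v Hu Hv Huv. apply Hd in Hu, Hv.
    destruct Hu as [Hu| ->], Hv as [Hv| ->].
    + apply HS with c; auto.
    + apply ok_set_mono with m; auto.
    + apply Hw in Hv. destruct (lt_irrefl v). eauto using lt_trans.
    + now destruct (lt_irrefl w).
  - intros c m d (w & Hmw & Hw & Hd) HdS. apply HS.
    intros u v Hu Hv. apply HS with d; auto; apply Hd; auto.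
Qed.

(** The infinite set [H] is greedy: from [n0] on, a number enters as soon as some code of the
    enlarged initial segment is in [S]. Greed meets no dead end, since every set reached has almost
    all its children in [S]. *)
Lemma clopen_branch S : (exists c, c ∈ S) -> (forall c, c ∈ S -> node ok c) ->
  (forall c, c ∈ S -> exists m, forall d, child c m d -> d ∈ S) ->
  exists V, forall v, exists w, ok_set V v w.
Proof.
  intros [c0 Hc0] Snode Sstep.
  destruct (elem_bounded c0) as [n0 Hn0].
  assert (HF : exists F, forall z, z ∈ F <-> exists c n, z = pair c n /\
    ((n < n0 /\ elem n c0) \/
     (n0 <= n /\ exists d, d ∈ S /\ forall x, elem x d <-> elem x c \/ x = n)))
    by comprehend.
  destruct HF as [F HF]. destruct (recursion F) as [H HH].
  assert (H_lt : forall n, n < n0 -> (n ∈ H <-> elem n c0)).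
  { intros n Hn. rewrite HH. split.
    - intros (c & _ & HcF). apply HF in HcF. destruct HcF as (c' & n' & E & HcF).
      apply pair_inj in E. destruct E as [<- <-].
      destruct HcF as [[_ HcF]|[Hle _]]; [exact HcF|].
      destruct (lt_not_le n n0 Hn Hle).
    - intros He. destruct (code_exists H n) as [c Hc]. exists c. split; [exact Hc|].
      apply HF. exists c, n. auto. }
  assert (H_ge : forall n, n0 <= n -> (n ∈ H <-> exists c d, code_of c H n /\ d ∈ S /\
                   forall x, elem x d <-> elem x c \/ x = n)).
  { intros n Hn. rewrite HH. split.
    - intros (c & Hc & HcF). apply HF in HcF. destruct HcF as (c' & n' & E & HcF).
      apply pair_inj in E. destruct E as [<- <-].
      destruct HcF as [[Hlt _]|[_ [d Hd]]]; [now apply lt_not_le in Hlt|eauto].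
    - intros (c & d & Hc & Hd). exists c; split; [exact Hc|].
      apply HF. exists c, n; split; [reflexivity|]. right; eauto. }
  assert (H_code : forall k, exists c, c ∈ S /\ code_of c H (n0 + k)).
  { ind.
    - exists c0. rewrite add_0_r. split; [exact Hc0|]. intros x. split.
      + intros Hx. split; [|auto]. apply H_lt; auto.
      + intros [Hx Hlt]. now apply H_lt.
    - intros k [c [Hc Hcode]]. rewrite add_assoc.
      destruct (classic (n0 + k ∈ H)) as [Hk|Hk].
      + pose proof Hk as Hk'. apply H_ge in Hk'; [|apply le_add_r].
        destruct Hk' as (c' & d & Hc' & Hd & Hd').
        exists d; split; [exact Hd|]. intros x. rewrite (Hd' x), (Hc' x), lt_succ_r.
        split; [intros [?| ->]; tauto|tauto].
      + exists c; split; [exact Hc|]. intros x. rewrite (Hcode x), lt_succ_r.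
        split; [tauto|]. intros [Hx [Hlt| ->]]; tauto. }
  assert (H_inf : forall n, exists w, w ∈ H /\ n <= w).
  { intros n. apply NNPP; intros Hn.
    destruct (H_code n) as [c [Hc Hcode]]. destruct (Sstep c Hc) as [m Hm].
    (* If [H] stopped before [n], this number would exceed all of [H] and be large enough for
       [Sstep], so the greedy rule would take it. *)
    set (w := n0 + n + m).
    assert (Hw : n0 + n <= w) by apply le_add_r.
    assert (Hcw : code_of c H w).
    { intros x. rewrite (Hcode x). split.
      - intros [Hx Hlt]; split; eauto using lt_le_trans.
      - intros [Hx Hlt]; split; [exact Hx|].
        destruct (le_or_lt (n0 + n) x) as [Hl|Hl]; [|exact Hl].
        destruct Hn. exists x. split; [exact Hx|].
        apply le_trans with (n0 + n); auto using le_add_l. }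
    assert (HX : exists X, forall x, x ∈ X <-> elem x c \/ x = w) by comprehend.
    destruct HX as [X HX]. destruct (code_exists X (w + 1)) as [d Hd].
    assert (Hd' : forall x, elem x d <-> elem x c \/ x = w).
    { intros x. rewrite (Hd x), HX. split; [tauto|].
      intros Hx; split; [exact Hx|]. destruct Hx as [Hx| ->].
      - apply Hcw in Hx. apply lt_le; tauto.
      - apply le_refl. }
    apply Hn. exists w. split.
    - apply H_ge; [apply le_trans with (n0 + n); auto using le_add_r|].
      exists c, d. split; [exact Hcw|]. split; [|exact Hd'].
      apply Hm. exists w. repeat split; auto.
      + apply le_add_l.
      + intros x Hx. apply Hcw in Hx. tauto.
      + now intros Hx; apply Hd'.
      + now intros Hx; apply Hd'.
    - apply le_trans with (n0 + n); auto using le_add_l. }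
  (* Weak König's lemma: [V] is the leftmost branch of the binary tree of the
     finite sets that can be extended to arbitrarily long good ones. *)
  set (good := fun s w => forall u v, u ∈ H -> v ∈ H -> u < v -> v < w -> ok s u v).
  assert (good_exists : forall w, exists s, good s w).
  { intros w. destruct (H_code w) as [c [Hc Hcode]].
    destruct (Snode c Hc) as [s Hs]. exists s. intros u v Hu Hv Huv Hvw.
    assert (v < n0 + w) by eauto using lt_le_trans, le_add_l.
    apply Hs; auto; apply Hcode; split; eauto using lt_trans. }
  set (ext := fun s n => forall w, exists s',
    (forall x, x < n -> (elem x s' <-> elem x s)) /\ good s' w).
  (* A code of [V] below [n], read below [n + 1], leaves [n] out; so [n] enters [V] only if leaving
     it out cannot be extended. *)
  assert (HF2 : exists F, forall z, z ∈ F <-> exists c n, z = pair c n /\ ~ ext c (n + 1))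
    by comprehend.
  destruct HF2 as [F2 HF2]. destruct (recursion F2) as [V HV].
  assert (V_ext : forall n c, code_of c V n -> ext c n).
  { ind.
    - intros c _ w. destruct (good_exists w) as [s Hs]. exists s. split; [|exact Hs].
      intros x Hx; now apply lt_0_r in Hx.
    - intros n IH c Hc. destruct (code_exists V n) as [c1 Hc1].
      destruct (classic (n ∈ V)) as [Hn|Hn].
      + pose proof Hn as Hn'. apply HV in Hn'. destruct Hn' as (c2 & Hc2 & HcF).
        apply HF2 in HcF. destruct HcF as (c' & n' & E & Hext).
        apply pair_inj in E. destruct E as [<- <-].
        apply not_all_ex_not in Hext. destruct Hext as [w1 Hw1].
        (* Goodness up to [w + w1] settles both cases: with [n], the extension serves for [w];
           without [n], it contradicts the failure at [w1]. *)
        intros w. destruct (IH c1 Hc1 (w + w1)) as (s & Hs & Hgood).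
        destruct (classic (elem n s)) as [Hns|Hns].
        * exists s. split.
          -- intros x Hx. rewrite (Hc x). apply lt_succ_r in Hx. destruct Hx as [Hx| ->].
             ++ rewrite (Hs x Hx), (Hc1 x), lt_succ_r. tauto.
             ++ pose proof (le_refl n). tauto.
          -- intros u v Hu Hv Huv Hvw. apply Hgood; eauto using lt_le_trans, le_add_r.
        * destruct Hw1. exists s. split.
          -- intros x Hx. rewrite (Hc2 x). apply lt_succ_r in Hx. destruct Hx as [Hx| ->].
             ++ rewrite (Hs x Hx), (Hc1 x). tauto.
             ++ pose proof (lt_irrefl n). tauto.
          -- intros u v Hu Hv Huv Hvw. apply Hgood; eauto using lt_le_trans, le_add_l.
      + assert (Hext : ext c1 (n + 1)).
        { apply NNPP; intros Hext. apply Hn, HV. exists c1; split; [exact Hc1|].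
          apply HF2. eauto. }
        intros w. destruct (Hext w) as (s & Hs & Hgood). exists s. split; [|exact Hgood].
        intros x Hx. rewrite (Hs x Hx), (Hc x), (Hc1 x), lt_succ_r.
        split; [tauto|]. intros [Hx' [?| ->]]; tauto. }
  exists V. intros v.
  destruct (H_inf v) as (u & Hu & Hvu), (H_inf (u + 1)) as (w & Hw & Huw).
  exists w. intros s Hs. apply ok_anti with u; [exact Hvu|].
  destruct (V_ext w s Hs (w + 1)) as (s' & Hs' & Hgood).
  apply ok_ext with s'; [auto|]. apply Hgood; auto using le_refl.
  apply lt_le_trans with (u + 1); auto using le_refl.
Qed.
End Tree.

Lemma zero_neq_one : 0 <> 1.
Proof. intros H. apply (@succ_neq0 0). rewrite <- H. apply add_0_r. Qed.

Lemma zero_neq_two : 0 <> 1 + 1.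
Proof. intros H. apply (@succ_neq0 1). auto. Qed.

Lemma one_neq_two : 1 <> 1 + 1.
Proof.
  intros H. apply zero_neq_one. apply add_cancel_r with 1. now rewrite add_0_l.
Qed.

Ltac inj :=
  repeat match goal with
  | H : exists x, _ |- _ => destruct H
  | H : _ /\ _ |- _ => destruct H
  | H : pair _ _ = pair _ _ |- _ => apply pair_inj in H; destruct H
  | H : 0 = 1 |- _ => destruct (zero_neq_one H)
  | H : 1 = 0 |- _ => destruct (zero_neq_one (eq_sym H))
  | H : 0 = 1 + 1 |- _ => destruct (zero_neq_two H)
  | H : 1 + 1 = 0 |- _ => destruct (zero_neq_two (eq_sym H))
  | H : 1 = 1 + 1 |- _ => destruct (one_neq_two H)
  | H : 1 + 1 = 1 |- _ => destruct (one_neq_two (eq_sym H))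
  end; subst.

(** * The space of a tree *)

Section Space.
Variable T : N -> Prop.

Definition point (x : N) : Prop := exists c, x = pair 0 c \/ x = pair 1 c.

(** The points are the isolated points [pair 0 c] and the limit points [pair 1 c].
    The basic neighbourhood of [pair 1 c] with index [pair 1 (pair c m)] consists of
    [pair 1 c] and of the [pair 0 d] with [near c m d]; it forces a clopen set to agree
    on [c] and almost all its children if [c] is in [T], and on all numbers outside
    of [T]. *)
Definition near (c m d : N) : Prop :=
  d = c \/ (T c /\ child c m d) \/ (~ T c /\ ~ T d).

Definition basic (x i : N) : Prop :=
  (exists c, i = pair 0 c /\ x = pair 0 c) \/
  (exists c m, i = pair 1 (pair c m) /\
     (x = pair 1 c \/ exists d, x = pair 0 d /\ near c m d)).

(** At an isolated point the singleton serves for all [i] and [j]. At a limit point the two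
    neighbourhoods are nested, and the one with the larger bound is the intersection. *)
Definition meet (x i j y : N) : Prop :=
  (exists d, x = pair 0 d /\ y = pair 0 d) \/
  (exists c m m', x = pair 1 c /\ i = pair 1 (pair c m) /\ j = pair 1 (pair c m') /\
     ((m' <= m /\ y = i) \/ (m < m' /\ y = j))).

Definition quad (x i j y : N) : N := pair (pair (pair x i) j) y.

Definition space (z : N) : Prop :=
  (exists x, z = pair x 0 /\ point x) \/
  (exists x i, z = pair (pair x i) 1 /\ basic x i) \/
  (exists x i j y, z = pair (quad x i j y) (1 + 1) /\ point x /\ meet x i j y).

Definition inX (X : set M) (x : N) : Prop := pair x 0 ∈ X.
Definition inU (X : set M) (x i : N) : Prop := pair (pair x i) 1 ∈ X.
Definition inG (X : set M) (n : N) : Prop := pair n (1 + 1) ∈ X.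

Definition csc (X : set M) : Prop :=
  (forall x i, inU X x i -> inX X x) /\
  (forall x, inX X x -> exists i, inU X x i) /\
  ((forall n, inG X n -> exists x i j y, n = quad x i j y /\ inX X x) /\
   (forall x i j y z, inG X (quad x i j y) -> inG X (quad x i j z) -> y = z)) /\
  (forall x i j, inU X x i /\ inU X x j ->
     exists y, (inG X (quad x i j y) /\ inU X x y) /\
       forall z, inU X z y -> inU X z i /\ inU X z j).

Definition is_open (X : set M) (A : N -> Prop) : Prop :=
  (forall x, A x -> inX X x) /\
  (forall x, A x -> exists i, inU X x i /\ forall z, inU X z i -> A z).

(** [A] and [B] are predicates so that this also covers two columns of a single set. *)
Definition connects (X : set M) (A B : N -> Prop) : Prop :=
  is_open X A /\ is_open X B /\ (exists x, A x) /\ (exists x, B x) /\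
  (forall x, inX X x <-> A x \/ B x) -> exists x, A x /\ B x.

Lemma sat_connected_CSC_space rho sig X :
  sat M rho (scons X sig) connected_CSC_space <->
  csc X /\ forall A B, connects X (fun x => x ∈ A) (fun x => x ∈ B).
Proof. reify. Qed.

Variable X : set M.
Hypothesis X_space : forall z, z ∈ X <-> space z.

Lemma inX_iff x : inX X x <-> point x.
Proof.
  unfold inX. rewrite X_space. split.
  - intros [H|[H|H]]; inj; auto.
  - intros H. left; eauto.
Qed.

Lemma inU_iff x i : inU X x i <-> basic x i.
Proof.
  unfold inU. rewrite X_space. split.
  - intros [H|[H|H]]; inj; auto.
  - intros H. right; left; eauto.
Qed.

Lemma inG_iff x i j y : inG X (quad x i j y) <-> point x /\ meet x i j y.
Proof.
  unfold inG. rewrite X_space. split.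
  - intros [H|[H|H]]; inj; try (unfold quad in *; inj; auto; fail).
  - intros H. right; right. exists x, i, j, y; tauto.
Qed.

Lemma near_anti c m m' d : m' <= m -> near c m d -> near c m' d.
Proof.
  intros Hm [H|[[H1 (w & Hw & H)]|H]]; unfold near; auto.
  right; left. split; [exact H1|]. exists w. split; [eauto using le_trans|exact H].
Qed.

Lemma basic_anti x c m m' :
  m' <= m -> basic x (pair 1 (pair c m)) -> basic x (pair 1 (pair c m')).
Proof.
  intros Hm [[d [H _]]|(c' & m0 & E & H)]; inj. right. exists c', m'.
  split; [reflexivity|]. destruct H as [H|[d [-> H]]]; [auto|].
  right. eauto using near_anti.
Qed.

Lemma basic_limit x i : basic x i ->
  (exists d, x = pair 0 d) \/ exists c m, x = pair 1 c /\ i = pair 1 (pair c m).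
Proof.
  intros [[d [-> ->]]|(c & m & -> & [->|[d [-> _]]])]; eauto.
Qed.

Lemma space_csc : csc X.
Proof.
  split; [|split; [|split; [split|]]].
  - intros x i. rewrite inU_iff, inX_iff. unfold point.
    intros [H|H]; inj; eauto. destruct H0; inj; eauto.
  - intros x. rewrite inX_iff. intros [c [->| ->]].
    + exists (pair 0 c). rewrite inU_iff. left; eauto.
    + exists (pair 1 (pair c 0)). rewrite inU_iff. right; eauto.
  - intros n. unfold inG. rewrite X_space. intros [H|[H|H]]; inj.
    do 4 eexists. split; [reflexivity|]. now apply inX_iff.
  - intros x i j y z. rewrite !inG_iff.
    intros [_ [(d & -> & ->)|(c & m & m' & -> & -> & -> & Hy)]]
      [_ [(d' & E & ->)|(c' & n & n' & E & E1 & E2 & Hz)]]; inj; auto.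
    destruct Hy as [[Hy ->]|[Hy ->]], Hz as [[Hz ->]|[Hz ->]]; auto.
    + destruct (lt_not_le _ _ Hz Hy).
    + destruct (lt_not_le _ _ Hy Hz).
  - intros x i j. rewrite !inU_iff. intros [Hi Hj].
    destruct (basic_limit Hi) as [[d ->]|(c & m & -> & ->)].
    + exists (pair 0 d). rewrite inG_iff, inU_iff. split; [split; [split|]|].
      * exists d; auto.
      * left; eauto.
      * left; eauto.
      * intros z. rewrite !inU_iff. intros [[d' [E ->]]|(c & m & E & _)]; inj. auto.
    + destruct (basic_limit Hj) as [[d E]|(c' & m' & E & ->)]; inj.
      assert (Hp : point (pair 1 c')) by (exists c'; auto).
      destruct (le_or_lt m' m) as [Hm|Hm].
      * exists (pair 1 (pair c' m)). rewrite inG_iff, inU_iff. repeat split; auto.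
        -- right. exists c', m, m'. repeat split; auto.
        -- rewrite inU_iff in *. now apply basic_anti with m.
      * exists (pair 1 (pair c' m')). rewrite inG_iff, inU_iff. repeat split; auto.
        -- right. exists c', m, m'. repeat split; auto.
        -- rewrite inU_iff in *. apply basic_anti with m'; auto. now apply lt_le.
Qed.

(** Both points of each number go to the same side. [Sdown] keeps the side of [S] open and [Sup] the
    other one; the identification of the numbers outside [T] respects the sides, since [S] lies
    inside [T]. *)
Lemma clopen_disconnects S :
  (exists c, c ∈ S) -> (exists c, ~ T c) -> (forall c, c ∈ S -> T c) ->
  (forall c, c ∈ S -> exists m, forall d, child c m d -> d ∈ S) ->
  (forall c m d, child c m d -> d ∈ S -> c ∈ S) ->
  ~ forall A B, connects X (fun x => x ∈ A) (fun x => x ∈ B).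
Proof.
  intros [c0 Hc0] [c1 Hc1] ST Sdown Sup H.
  assert (HA : exists A, forall x, x ∈ A <-> exists c, c ∈ S /\ (x = pair 0 c \/ x = pair 1 c))
    by comprehend.
  assert (HB : exists B, forall x, x ∈ B <-> exists c, ~ c ∈ S /\ (x = pair 0 c \/ x = pair 1 c))
    by comprehend.
  destruct HA as [A HA], HB as [B HB].
  assert (A0 : forall c, pair 0 c ∈ A <-> c ∈ S).
  { intros c. rewrite HA. split; [intros (c' & Hc & [E|E]); inj; auto|eauto]. }
  assert (A1 : forall c, pair 1 c ∈ A <-> c ∈ S).
  { intros c. rewrite HA. split; [intros (c' & Hc & [E|E]); inj; auto|eauto]. }
  assert (B0 : forall c, pair 0 c ∈ B <-> ~ c ∈ S).
  { intros c. rewrite HB. split; [intros (c' & Hc & [E|E]); inj; auto|eauto]. }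
  assert (B1 : forall c, pair 1 c ∈ B <-> ~ c ∈ S).
  { intros c. rewrite HB. split; [intros (c' & Hc & [E|E]); inj; auto|eauto]. }
  destruct (H A B) as [x [Hx Hx']].
  - repeat split.
    + intros x Hx. apply inX_iff. apply HA in Hx. destruct Hx as (c & _ & Hx). now exists c.
    + intros x Hx. apply HA in Hx. destruct Hx as (c & Hc & [->| ->]).
      * exists (pair 0 c). rewrite inU_iff. split; [left; eauto|].
        intros z. rewrite inU_iff. intros [(d & E & ->)|(d & m & E & _)]; inj. now apply A0.
      * destruct (Sdown c Hc) as [m Hm].
        exists (pair 1 (pair c m)). rewrite inU_iff. split; [right; eauto|].
        intros z. rewrite inU_iff. intros [(d & E & ->)|(d & m' & E & Hz)]; inj.
        destruct Hz as [->|(d' & -> & [->|[[_ Hz]|[Hz _]]])]; [now apply A1|now apply A0| |].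
        -- now apply A0, Hm.
        -- destruct Hz; auto.
    + intros x Hx. apply inX_iff. apply HB in Hx. destruct Hx as (c & _ & Hx). now exists c.
    + intros x Hx. apply HB in Hx. destruct Hx as (c & Hc & [->| ->]).
      * exists (pair 0 c). rewrite inU_iff. split; [left; eauto|].
        intros z. rewrite inU_iff. intros [(d & E & ->)|(d & m & E & _)]; inj. now apply B0.
      (* Every bound works here, since by [Sup] a number outside [S] has no child in [S]. *)
      * exists (pair 1 (pair c 0)). rewrite inU_iff. split; [right; eauto|].
        intros z. rewrite inU_iff. intros [(d & E & ->)|(d & m' & E & Hz)]; inj.
        destruct Hz as [->|(d' & -> & [->|[[_ Hz]|[_ Hz]]])]; [now apply B1|now apply B0| |].
        -- apply B0. eauto.
        -- apply B0. auto.
    + exists (pair 0 c0). now apply A0.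
    + exists (pair 0 c1). apply B0. auto.
    + intros Hx. apply inX_iff in Hx. destruct Hx as [c Hx].
      destruct (classic (c ∈ S)); [left; apply HA|right; apply HB]; eauto.
    + intros [Hx|Hx]; apply inX_iff; [apply HA in Hx|apply HB in Hx];
        destruct Hx as (c & _ & Hx); now exists c.
  - apply HA in Hx. apply HB in Hx'. destruct Hx as (c & Hc & [->| ->]), Hx' as (c' & Hc' & [E|E]);
      inj; auto.
Qed.

(** If the sides were disjoint, a limit point would lie with its isolated point, and all numbers
    outside [T] on the side of [p]. The numbers on the other side would then form a set that [HT]
    excludes. *)
Lemma no_clopen_connects A B :
  (exists c, ~ T c) ->
  (forall S, (exists c, c ∈ S) -> (forall c, c ∈ S -> T c) ->
     ~ forall c, c ∈ S -> exists m, forall d, child c m d -> d ∈ S) ->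
  connects X (fun x => x ∈ A) (fun x => x ∈ B).
Proof.
  intros [p Hp] HT.
  assert (main : forall A B, is_open X (fun x => x ∈ A) -> is_open X (fun x => x ∈ B) ->
    (exists x, x ∈ A) -> (forall x, inX X x <-> x ∈ A \/ x ∈ B) ->
    pair 0 p ∈ B -> exists x, x ∈ A /\ x ∈ B).
  { clear A B. intros A B [AX Ao] [BX Bo] [a Ha] HAB HpB. apply NNPP; intros Hdisj.
    assert (dis : forall x, x ∈ A -> ~ x ∈ B) by (intros x H1 H2; apply Hdisj; eauto).
    assert (nbhd : forall c i, inU X (pair 1 c) i -> exists m, i = pair 1 (pair c m) /\
      inU X (pair 0 c) i /\ forall d, near c m d -> inU X (pair 0 d) i).
    { intros c i Hi. apply inU_iff in Hi. destruct Hi as [(d & -> & E)|(c' & m & -> & Hi)]; inj.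
      destruct Hi as [E|(d & E & _)]; inj. exists m. split; [reflexivity|].
      split; [|intros d Hd]; apply inU_iff; right; do 2 eexists; (split; [reflexivity|]);
        right; eexists; (split; [reflexivity|]); [now left|exact Hd]. }
    assert (pA : forall c, pair 0 c ∈ A -> pair 1 c ∈ A).
    { intros c Hc. assert (H1 : inX X (pair 1 c)) by (apply inX_iff; exists c; auto).
      apply HAB in H1. destruct H1 as [H1|H1]; [exact H1|].
      destruct (Bo _ H1) as [i [Hi Hi']]. destruct (nbhd c i Hi) as (m & _ & H2 & _).
      now destruct (dis (pair 0 c) Hc); apply Hi'. }
    assert (HS : exists S, forall c, c ∈ S <-> pair 0 c ∈ A) by comprehend.
    destruct HS as [S HS]. apply (HT S).
    - assert (H1 : point a) by now apply inX_iff, HAB; left.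
      destruct H1 as [c [->| ->]]; exists c; apply HS; [exact Ha|].
      destruct (Ao _ Ha) as [i [Hi Hi']]. destruct (nbhd c i Hi) as (m & _ & H2 & _). auto.
    - intros c Hc. apply HS in Hc. apply NNPP; intros Hn.
      destruct (Ao _ (pA c Hc)) as [i [Hi Hi']]. destruct (nbhd c i Hi) as (m & _ & _ & H2).
      apply (dis (pair 0 p)); [|exact HpB]. apply Hi', H2. right; right; auto.
    - intros c Hc. apply HS in Hc.
      destruct (Ao _ (pA c Hc)) as [i [Hi Hi']]. destruct (nbhd c i Hi) as (m & _ & _ & H2).
      exists m. intros d Hd. apply HS, Hi', H2. right; left. split; [|exact Hd].
      apply NNPP; intros Hn. apply (dis (pair 0 p)); [|exact HpB].
      apply Hi', H2. right; right; auto. }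
  intros (HA & HB & nA & nB & HAB).
  assert (Hp0 : inX X (pair 0 p)) by (apply inX_iff; exists p; auto).
  apply HAB in Hp0. destruct Hp0 as [Hp0|Hp0]; [|now apply main].
  destruct (main B A) as [x Hx]; auto.
  - intros x. rewrite HAB. tauto.
  - exists x; tauto.
Qed.

End Space.

(** * Truth valuations of an arithmetical formula *)

(** The projections are functions of the metatheory, obtained by choice; formulas mention only these
    arithmetical graphs. *)
Definition is_fst (z a : N) : Prop :=
  (exists b, z = pair a b) \/ (a = 0 /\ ~ exists b c, z = pair b c).
Definition is_snd (z a : N) : Prop :=
  (exists b, z = pair b a) \/ (a = 0 /\ ~ exists b c, z = pair b c).

Definition nfst (z : N) : N := epsilon (inhabits 0) (is_fst z).
Definition nsnd (z : N) : N := epsilon (inhabits 0) (is_snd z).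

Lemma nfst_spec z a : a = nfst z <-> is_fst z a.
Proof.
  assert (H : is_fst z (nfst z)).
  { apply (epsilon_spec (inhabits 0) (is_fst z)). unfold is_fst.
    destruct (classic (exists b c, z = pair b c)) as [(b & c & E)|Hn];
      [exists b|exists 0]; eauto. }
  split; [now intros ->|]. unfold is_fst in H.
  intros [[b E]|[E Hn]]; destruct H as [[c E']|[E' Hn']]; subst; auto.
  - now apply pair_inj in E'.
  - destruct Hn'; eauto.
  - destruct Hn; eauto.
Qed.

Lemma nsnd_spec z a : a = nsnd z <-> is_snd z a.
Proof.
  assert (H : is_snd z (nsnd z)).
  { apply (epsilon_spec (inhabits 0) (is_snd z)). unfold is_snd.
    destruct (classic (exists b c, z = pair b c)) as [(b & c & E)|Hn];
      [exists c|exists 0]; eauto. }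
  split; [now intros ->|]. unfold is_snd in H.
  intros [[b E]|[E Hn]]; destruct H as [[c E']|[E' Hn']]; subst; auto.
  - now apply pair_inj in E'.
  - destruct Hn'; eauto.
  - destruct Hn; eauto.
Qed.

(** Every number codes an assignment of all number variables; the projections of a
    number that is not a pair are 0. *)
Fixpoint env (e : N) (n : nat) : N :=
  match n with
  | O => nfst e
  | S n => env (nsnd e) n
  end.

Lemma env_pair x e : env (pair x e) = scons x (env e).
Proof.
  apply functional_extensionality; intros [|n]; cbn [env scons].
  - symmetry; apply nfst_spec. left; eauto.
  - replace (nsnd (pair x e)) with e; [reflexivity|]. apply nsnd_spec. left; eauto.
Qed.

Definition val (t : term) (e a : N) : Prop := a = eval M (env e) t.

Definition left1 (p : N -> Prop) (q : N) : Prop := p (pair 1 q).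
Definition left2 (p : N -> Prop) (q : N) : Prop := p (pair (1 + 1) q).

(** [cond] expresses that a valuation obeys Tarski's clauses at the assignment
    [e].  The valuation is a set of pairs: [(0, e)] stands for the truth of the
    formula itself at [e], and the columns 1 and 2 hold the valuations of its
    immediate subformulas.  Only the elements known to be in it ([p]) or known to be
    out of it ([n]) may be used, so that [cond] is monotone in [p] and [n].
    The set variable 0 is interpreted by [pY] and [nY], all others by [Z]. *)
Fixpoint cond (Z : set M) (B : formula) (p n pY nY : N -> Prop) (e x : N) : Prop :=
  match B with
  | fbot => n (pair 0 e)
  | feq s t =>
      exists a b, val s e a /\ val t e b /\
        ((p (pair 0 e) /\ a = b) \/ (n (pair 0 e) /\ ~ a = b))
  | flt s t =>
      exists a b, val s e a /\ val t e b /\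
        ((p (pair 0 e) /\ a < b) \/ (n (pair 0 e) /\ ~ a < b))
  | fmem t O =>
      exists a, val t e a /\ ((p (pair 0 e) /\ pY a) \/ (n (pair 0 e) /\ nY a))
  | fmem t (S _) =>
      exists a, val t e a /\ ((p (pair 0 e) /\ a ∈ Z) \/ (n (pair 0 e) /\ ~ a ∈ Z))
  | fimp B C =>
      cond Z B (left1 p) (left1 n) pY nY e x /\ cond Z C (left2 p) (left2 n) pY nY e x /\
      ((p (pair 0 e) /\ (left1 n (pair 0 e) \/ left2 p (pair 0 e))) \/
       (n (pair 0 e) /\ left1 p (pair 0 e) /\ left2 n (pair 0 e)))
  | falln B =>
      cond Z B (left1 p) (left1 n) pY nY e x /\
      ((p (pair 0 e) /\ left1 p (pair 0 (pair x e))) \/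
       (n (pair 0 e) /\ exists y, left1 n (pair 0 (pair y e))))
  | falls _ => False
  end.

Definition eventually (P : N -> Prop) : Prop := exists m, forall w, m <= w -> P w.

Lemma eventually_const (P : Prop) : P -> eventually (fun _ => P).
Proof. exists 0; auto. Qed.

Lemma eventually_and P Q : eventually P -> eventually Q -> eventually (fun w => P w /\ Q w).
Proof.
  intros [m Hm] [m' Hm']. exists (m + m'). intros w Hw. split.
  - apply Hm; eauto using le_trans, le_add_r.
  - apply Hm'; eauto using le_trans, le_add_l.
Qed.

Lemma eventually_mono (P Q : N -> Prop) : (forall w, P w -> Q w) -> eventually P -> eventually Q.
Proof. intros H [m Hm]; exists m; auto. Qed.

(** At fixed [e] and [x] a true instance rests on finitely many membership facts, as the clause for
    [falln] looks at the single [x] or at one counterexample [y]. Each of these facts is known from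
    some stage on. *)
Lemma cond_eventually Z B : forall p n pY nY (p' n' pY' nY' : N -> N -> Prop) e x,
  (forall q, p q -> eventually (p' q)) -> (forall q, n q -> eventually (n' q)) ->
  (forall q, pY q -> eventually (pY' q)) -> (forall q, nY q -> eventually (nY' q)) ->
  cond Z B p n pY nY e x ->
  eventually (fun w => cond Z B (fun q => p' q w) (fun q => n' q w)
                         (fun q => pY' q w) (fun q => nY' q w) e x).
Proof.
  induction B as [|s t|s t|t [|X]|B IHB C IHC|B IHB|B IHB];
    intros p n pY nY p' n' pY' nY' e x Hp Hn HpY HnY; cbn [cond].
  - apply Hn.
  - intros (a & b & Ha & Hb & [[H1 H2]|[H1 H2]]); [apply Hp in H1|apply Hn in H1];
      (eapply eventually_mono; [|exact H1]); intros w Hw; exists a, b; auto.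
  - intros (a & b & Ha & Hb & [[H1 H2]|[H1 H2]]); [apply Hp in H1|apply Hn in H1];
      (eapply eventually_mono; [|exact H1]); intros w Hw; exists a, b; auto.
  - intros (a & Ha & [[H1 H2]|[H1 H2]]);
      [apply Hp in H1; apply HpY in H2|apply Hn in H1; apply HnY in H2];
      (eapply eventually_mono; [|exact (eventually_and H1 H2)]); intros w [Hw Hw']; exists a; auto.
  - intros (a & Ha & [[H1 H2]|[H1 H2]]); [apply Hp in H1|apply Hn in H1];
      (eapply eventually_mono; [|exact H1]); intros w Hw; exists a; auto.
  - intros (H1 & H2 & H3).
    apply eventually_and; [|apply eventually_and].
    + apply (IHB (left1 p) (left1 n) pY nY (fun q => p' (pair 1 q)) (fun q => n' (pair 1 q)));
        unfold left1; auto.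
    + apply (IHC (left2 p) (left2 n) pY nY
               (fun q => p' (pair (1 + 1) q)) (fun q => n' (pair (1 + 1) q)));
        unfold left2; auto.
    + unfold left1, left2 in *. destruct H3 as [[H3 [H4|H4]]|(H3 & H4 & H5)].
      * apply Hp in H3. apply Hn in H4. eapply eventually_mono; [|exact (eventually_and H3 H4)]. simpl; tauto.
      * apply Hp in H3. apply Hp in H4. eapply eventually_mono; [|exact (eventually_and H3 H4)]. simpl; tauto.
      * apply Hn in H3. apply Hp in H4. apply Hn in H5.
        eapply eventually_mono; [|exact (eventually_and H3 (eventually_and H4 H5))]. simpl; tauto.
  - intros (H1 & H3). apply eventually_and.
    + apply (IHB (left1 p) (left1 n) pY nY (fun q => p' (pair 1 q)) (fun q => n' (pair 1 q)));
        unfold left1; auto.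
    + unfold left1, left2 in *. destruct H3 as [[H3 H4]|(H3 & y & H4)].
      * apply Hp in H3. apply Hp in H4. eapply eventually_mono; [|exact (eventually_and H3 H4)]. simpl; tauto.
      * apply Hn in H3. apply Hn in H4. eapply eventually_mono; [|exact (eventually_and H3 H4)].
        intros w [H5 H6]; right; eauto.
  - tauto.
Qed.

(** The case of [cond_eventually] in which the facts do not depend on the stage. *)
Lemma cond_mono Z B (p n pY nY p' n' pY' nY' : N -> Prop) e x :
  (forall q, p q -> p' q) -> (forall q, n q -> n' q) ->
  (forall q, pY q -> pY' q) -> (forall q, nY q -> nY' q) ->
  cond Z B p n pY nY e x -> cond Z B p' n' pY' nY' e x.
Proof.
  intros Hp Hn HpY HnY H.
  destruct (@cond_eventually Z B p n pY nY (fun q _ => p' q) (fun q _ => n' q)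
              (fun q _ => pY' q) (fun q _ => nY' q) e x) as [m Hm];
    auto using eventually_const.
  apply (Hm m (le_refl m)).
Qed.

Lemma cond_sound Z Y B : arithmetical B -> forall V : N -> Prop,
  (forall e x, cond Z B V (fun q => ~ V q) (fun a => a ∈ Y) (fun a => ~ a ∈ Y) e x) ->
  forall e, V (pair 0 e) <-> sat M (env e) (scons Y (fun _ => Z)) B.
Proof.
  induction B as [|s t|s t|t [|X]|B IHB C IHC|B IHB|B IHB];
    cbn [cond sat arithmetical scons]; intros HB V HV e.
  - specialize (HV e 0). tauto.
  - destruct (HV e 0) as (a & b & -> & -> & H). tauto.
  - destruct (HV e 0) as (a & b & -> & -> & H). tauto.
  - destruct (HV e 0) as (a & -> & H). tauto.
  - destruct (HV e 0) as (a & -> & H). tauto.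
  - destruct HB as [HB HC].
    rewrite <- (IHB HB (left1 V)), <- (IHC HC (left2 V)).
    + destruct (HV e 0) as (_ & _ & H). unfold left1, left2 in *. tauto.
    + intros e' x. now destruct (HV e' x) as (_ & H & _).
    + intros e' x. now destruct (HV e' x) as (H & _ & _).
  - assert (IH : forall x, left1 V (pair 0 (pair x e)) <->
                  sat M (scons x (env e)) (scons Y (fun _ => Z)) B).
    { intros x. rewrite <- env_pair. apply (IHB HB (left1 V)).
      intros e' x'. now destruct (HV e' x') as [H _]. }
    split.
    + intros H x. apply IH. destruct (HV e x) as [_ H']. tauto.
    (* Any instance would do in place of 0: if [pair 0 e] is out of [V], each of them supplies a
       counterexample [y]. *)
    + intros H. destruct (HV e 0) as [_ [[H' _]|[_ [y H']]]]; [exact H'|].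
      destruct H'. now apply IH.
  - tauto.
Qed.

Lemma reify_subst rho sig s r A P rho' sig' :
  (sat M rho' sig' A <-> P) ->
  (forall n, eval M rho (s n) = rho' n) -> (forall X, sig (r X) = sig' X) ->
  (sat M rho sig (subst s r A) <-> P).
Proof.
  intros HP Hs Hr. rewrite sat_subst, <- HP.
  replace rho' with (fun n => eval M rho (s n)) by now apply functional_extensionality.
  replace sig' with (fun X => sig (r X)) by now apply functional_extensionality.
  reflexivity.
Qed.

Lemma sat_lookup_formula n : forall rho sig e a,
  sat M (scons e (scons a rho)) sig (lookup_formula n) <-> a = env e n.
Proof.
  induction n as [|n IH]; intros rho sig e a; cbn [lookup_formula env].
  - rewrite nfst_spec. reify.
  - transitivity (exists d, is_snd e d /\ a = env d n).
    + apply reify_ex; intros d. apply reify_and; [reify|].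
      apply reify_subst with (scons d (scons a (fun _ => 0))) sig; auto.
      now intros [|[|k]].
    + split; [intros (d & Hd & ->); apply nsnd_spec in Hd; now subst|].
      intros ->. exists (nsnd e). split; [now apply nsnd_spec|reflexivity].
Qed.

Lemma sat_val_formula t : forall rho sig e a,
  sat M (scons e (scons a rho)) sig (val_formula t) <-> val t e a.
Proof.
  unfold val.
  induction t as [n| | |s IHs t IHt|s IHs t IHt]; intros rho sig e a;
    cbn [val_formula eval].
  - apply sat_lookup_formula.
  - reify.
  - reify.
  - transitivity (exists b c, val s e b /\ val t e c /\ a = b + c).
    + apply reify_ex; intros b; apply reify_ex; intros c. apply reify_and; [|apply reify_and; [|reify]].
      * apply reify_subst with (scons e (scons b (fun _ => 0))) sig; auto.
        now intros [|[|k]].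
      * apply reify_subst with (scons e (scons c (fun _ => 0))) sig; auto.
        now intros [|[|k]].
    + unfold val. split; [now intros (b & c & -> & -> & ->)|eauto].
  - transitivity (exists b c, val s e b /\ val t e c /\ a = b * c).
    + apply reify_ex; intros b; apply reify_ex; intros c. apply reify_and; [|apply reify_and; [|reify]].
      * apply reify_subst with (scons e (scons b (fun _ => 0))) sig; auto.
        now intros [|[|k]].
      * apply reify_subst with (scons e (scons c (fun _ => 0))) sig; auto.
        now intros [|[|k]].
    + unfold val. split; [now intros (b & c & -> & -> & ->)|eauto].
Qed.

Lemma reify_val rho sig t s u e a : eval M rho s = e -> eval M rho u = a ->
  (sat M rho sig (subst (scons s (scons u (fun _ => tzero))) (fun X => X) (val_formula t))
   <-> val t e a).
Proof.
  intros <- <-. eapply reify_subst; [apply sat_val_formula| |reflexivity].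
  intros [|[|k]]; [reflexivity|reflexivity|]. instantiate (1 := fun _ => 0). reflexivity.
Qed.

Ltac reify_hook ::=
  match goal with |- sat _ _ _ _ <-> val _ _ _ => eapply reify_val; [reify_term|reify_term] end.
(** Induction on [B] outside the structure: each step costs one instance of arithmetical
    comprehension with the valuations of the subformulas as parameters. *)
Lemma valuation_exists Z Y B : arithmetical B -> exists V : set M, forall e x,
  cond Z B (fun q => q ∈ V) (fun q => ~ q ∈ V) (fun a => a ∈ Y) (fun a => ~ a ∈ Y) e x.
Proof.
  induction B as [|s t|s t|t [|X]|B IHB C IHC|B IHB|B IHB]; cbn [cond arithmetical]; intros HB.
  - assert (H : exists V, forall q, q ∈ V <-> False) by comprehend.
    destruct H as [V HV]. exists V. intros e x. now rewrite HV.
  - assert (H : exists V, forall q, q ∈ V <->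
      exists e, q = pair 0 e /\ exists a b, val s e a /\ val t e b /\ a = b) by comprehend.
    destruct H as [V HV]. exists V. intros e x. do 2 eexists.
    split; [reflexivity|split; [reflexivity|]].
    assert (H : pair 0 e ∈ V <-> eval M (env e) s = eval M (env e) t).
    { rewrite HV. unfold val. split; [intros H; inj; congruence|eauto 9]. }
    rewrite H. tauto.
  - assert (H : exists V, forall q, q ∈ V <->
      exists e, q = pair 0 e /\ exists a b, val s e a /\ val t e b /\ a < b) by comprehend.
    destruct H as [V HV]. exists V. intros e x. do 2 eexists.
    split; [reflexivity|split; [reflexivity|]].
    assert (H : pair 0 e ∈ V <-> eval M (env e) s < eval M (env e) t).
    { rewrite HV. unfold val. split; [intros H; inj; congruence|eauto 9]. }
    rewrite H. tauto.
  - assert (H : exists V, forall q, q ∈ V <->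
      exists e, q = pair 0 e /\ exists a, val t e a /\ a ∈ Y) by comprehend.
    destruct H as [V HV]. exists V. intros e x. eexists. split; [reflexivity|].
    assert (H : pair 0 e ∈ V <-> eval M (env e) t ∈ Y).
    { rewrite HV. unfold val. split; [intros H; inj; congruence|eauto 9]. }
    rewrite H. tauto.
  - assert (H : exists V, forall q, q ∈ V <->
      exists e, q = pair 0 e /\ exists a, val t e a /\ a ∈ Z) by comprehend.
    destruct H as [V HV]. exists V. intros e x. eexists. split; [reflexivity|].
    assert (H : pair 0 e ∈ V <-> eval M (env e) t ∈ Z).
    { rewrite HV. unfold val. split; [intros H; inj; congruence|eauto 9]. }
    rewrite H. tauto.
  - destruct HB as [HB HC]. destruct (IHB HB) as [VB HVB], (IHC HC) as [VC HVC].
    assert (H : exists V, forall q, q ∈ V <->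
      (exists e, q = pair 0 e /\ (pair 0 e ∈ VB -> pair 0 e ∈ VC)) \/
      (exists q', q = pair 1 q' /\ q' ∈ VB) \/
      (exists q', q = pair (1 + 1) q' /\ q' ∈ VC)) by comprehend.
    destruct H as [V HV]. exists V.
    assert (V0 : forall e, pair 0 e ∈ V <-> (pair 0 e ∈ VB -> pair 0 e ∈ VC)).
    { intros e. rewrite HV. split; [intros [H|[H|H]]; inj; auto|eauto]. }
    assert (V1 : forall q, pair 1 q ∈ V <-> q ∈ VB).
    { intros q. rewrite HV. split; [intros [H|[H|H]]; inj; auto|eauto]. }
    assert (V2 : forall q, pair (1 + 1) q ∈ V <-> q ∈ VC).
    { intros q. rewrite HV. split; [intros [H|[H|H]]; inj; auto|eauto 6]. }
    intros e x. unfold left1, left2. split; [|split].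
    + eapply cond_mono; [..|exact (HVB e x)]; auto; intros q; rewrite V1; auto.
    + eapply cond_mono; [..|exact (HVC e x)]; auto; intros q; rewrite V2; auto.
    + rewrite V0, V1, V2. tauto.
  - destruct (IHB HB) as [VB HVB].
    assert (H : exists V, forall q, q ∈ V <->
      (exists e, q = pair 0 e /\ forall x, pair 0 (pair x e) ∈ VB) \/
      (exists q', q = pair 1 q' /\ q' ∈ VB)) by comprehend.
    destruct H as [V HV]. exists V.
    assert (V0 : forall e, pair 0 e ∈ V <-> forall x, pair 0 (pair x e) ∈ VB).
    { intros e. rewrite HV. split; [intros [H|H]; inj; auto|eauto]. }
    assert (V1 : forall q, pair 1 q ∈ V <-> q ∈ VB).
    { intros q. rewrite HV. split; [intros [H|H]; inj; auto|eauto]. }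
    intros e x. unfold left1. split.
    + eapply cond_mono; [..|exact (HVB e x)]; auto; intros q; rewrite V1; auto.
    + rewrite V0, V1. destruct (classic (forall x, pair 0 (pair x e) ∈ VB)) as [H|H].
      * left; auto.
      * right. split; [exact H|]. apply not_all_ex_not in H. destruct H as [y Hy].
        exists y. now rewrite V1.
  - destruct HB.
Qed.

(** * The tree of an arithmetical formula *)

Definition known_in (s w q : N) : Prop := q < w /\ elem q s.
Definition known_out (s w q : N) : Prop := q < w /\ ~ elem q s.

(** A set coding a pair [(Y, valuation)] in columns 0 and 1 refutes [C]. *)
Definition refutes (Z : set M) (C : formula) (p n : N -> Prop) (e x : N) : Prop :=
  cond Z C (left1 p) (left1 n) (fun a => p (pair 0 a)) (fun a => n (pair 0 a)) e x /\
  left1 n (pair 0 0).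

(** [known_in] and [known_out] both leave the numbers from [w] on undecided, so enlarging [w] only
    adds facts. *)
Definition tree_ok (Z : set M) (C : formula) (s v w : N) : Prop :=
  forall e x, e <= v -> x <= v -> refutes Z C (known_in s w) (known_out s w) e x.

Lemma refutes_mono Z C (p n p' n' : N -> Prop) e x :
  (forall q, p q -> p' q) -> (forall q, n q -> n' q) ->
  refutes Z C p n e x -> refutes Z C p' n' e x.
Proof.
  intros Hp Hn [H1 H2]. split; [|unfold left1 in *; auto].
  revert H1. apply cond_mono; unfold left1; auto.
Qed.

Lemma collection (R : set M) : (forall e, eventually (fun w => pair e w ∈ R)) ->
  forall n, eventually (fun w => forall e, e < n -> pair e w ∈ R).
Proof.
  intros H. ind.
  - exists 0. intros w _ e He. now apply lt_0_r in He.
  - intros n IH. apply (@eventually_mono (fun w => (forall e, e < n -> pair e w ∈ R) /\ pair n w ∈ R) _);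
      [|now apply eventually_and].
    intros w [H1 H2] e He. apply lt_succ_r in He. destruct He as [He| ->]; auto.
Qed.

(** [refutes] recurses on [C], so [reify] cannot unfold it for an unspecified [C]. The set is
    assumed here and supplied later by [refutes_formula]. *)
Definition refutes_definable (Z : set M) (C : formula) : Prop :=
  exists R, forall s w e x, pair (pair s w) (pair e x) ∈ R <->
    refutes Z C (known_in s w) (known_out s w) e x.

Section Reduction.
Variables (Z : set M) (C : formula).
Hypothesis C_arithmetical : arithmetical C.
Hypothesis refutes_def : refutes_definable Z C.

Lemma tree_ok_definable : exists K, ok K = tree_ok Z C.
Proof.
  destruct refutes_def as [R HR].
  assert (H : exists K, forall z, z ∈ K <-> exists s v w, z = pair s (pair v w) /\
    forall e x, e <= v -> x <= v -> pair (pair s w) (pair e x) ∈ R) by comprehend.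
  destruct H as [K HK]. exists K.
  apply functional_extensionality; intros s. apply functional_extensionality; intros v.
  apply functional_extensionality; intros w. apply propositional_extensionality.
  unfold ok, tree_ok. rewrite HK. split.
  - intros (s' & v' & w' & E & H) e x He Hx. inj. apply HR; auto.
  - intros H. exists s, v, w. split; [reflexivity|]. intros; apply HR; auto.
Qed.

Lemma tree_ok_ext s s' v w : (forall q, q < w -> (elem q s <-> elem q s')) ->
  tree_ok Z C s v w -> tree_ok Z C s' v w.
Proof.
  intros E H e x He Hx. generalize (H e x He Hx).
  apply refutes_mono; intros q [H1 H2]; split; auto; specialize (E q H1); tauto.
Qed.

Lemma tree_ok_mono s v w w' : w <= w' -> tree_ok Z C s v w -> tree_ok Z C s v w'.
Proof.
  intros E H e x He Hx. generalize (H e x He Hx).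
  apply refutes_mono; intros q [H1 H2]; split; eauto using lt_le_trans.
Qed.

Lemma tree_ok_anti s v v' w : v' <= v -> tree_ok Z C s v w -> tree_ok Z C s v' w.
Proof. intros E H e x He Hx. apply H; eauto using le_trans. Qed.

(** Facts known of a finite part are true of [V], so monotonicity carries the finite conditions over
    to [V], and [cond_sound] reads its column 1 as truth. *)
Lemma branch_counterexample V :
  (forall v, exists w, forall s, code_of s V w -> tree_ok Z C s v w) ->
  exists Y, ~ sat M (env 0) (scons Y (fun _ => Z)) C.
Proof.
  intros HV.
  assert (H : forall e x, refutes Z C (fun q => q ∈ V) (fun q => ~ q ∈ V) e x).
  { intros e x. destruct (HV (e + x)) as [w Hw]. destruct (code_exists V w) as [s Hs].
    generalize (Hw s Hs e x (le_add_r _ _) (le_add_l _ _)).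
    apply refutes_mono; intros q [H1 H2]; specialize (Hs q); tauto. }
  assert (HY : exists Y, forall a, a ∈ Y <-> pair 0 a ∈ V) by comprehend.
  destruct HY as [Y HY]. exists Y.
  rewrite <- (@cond_sound Z Y C C_arithmetical (left1 (fun q => q ∈ V))).
  - apply (H 0 0).
  - intros e x. destruct (H e x) as [H1 _]. revert H1.
    apply cond_mono; auto; intros q; now rewrite HY.
Qed.

(** By [cond_eventually] each single condition holds from some stage on; collection, once in [e] and
    once in [x], finds a common stage. Collection speaks of sets, whence [R1], [R2] and [R3]. *)
Lemma counterexample_branch Y :
  ~ sat M (env 0) (scons Y (fun _ => Z)) C ->
  exists V, forall v, exists w, forall s, code_of s V w -> tree_ok Z C s v w.
Proof.
  intros HY. destruct (@valuation_exists Z Y C C_arithmetical) as [V' HV'].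
  assert (HV : exists V, forall q, q ∈ V <->
    (exists a, q = pair 0 a /\ a ∈ Y) \/ (exists q', q = pair 1 q' /\ q' ∈ V')) by comprehend.
  destruct HV as [V HV]. exists V.
  assert (V0 : forall a, pair 0 a ∈ V <-> a ∈ Y).
  { intros a. rewrite HV. split; [intros [H|H]; inj; auto|eauto]. }
  assert (V1 : forall q, pair 1 q ∈ V <-> q ∈ V').
  { intros q. rewrite HV. split; [intros [H|H]; inj; auto|eauto]. }
  set (P := fun e x w => refutes Z C (fun q => q < w /\ q ∈ V) (fun q => q < w /\ ~ q ∈ V) e x).
  assert (HP : forall e x, eventually (P e x)).
  { intros e x. apply eventually_and.
    - assert (Hw : forall (A : Prop) q, A -> eventually (fun w => q < w /\ A)).
      { intros A q HA. exists (q + 1). intros w Hw. split; [|exact HA].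
        eauto using lt_le_trans, le_refl. }
      apply (@cond_eventually Z C (fun q => q ∈ V') (fun q => ~ q ∈ V')
        (fun a => a ∈ Y) (fun a => ~ a ∈ Y)
        (fun q w => pair 1 q < w /\ pair 1 q ∈ V) (fun q w => pair 1 q < w /\ ~ pair 1 q ∈ V)
        (fun q w => pair 0 q < w /\ pair 0 q ∈ V) (fun q w => pair 0 q < w /\ ~ pair 0 q ∈ V));
        [..|apply HV']; intros q Hq; apply Hw; rewrite ?V0, ?V1; exact Hq.
    - exists (pair 1 (pair 0 0) + 1). intros w Hw. split.
      + eauto using lt_le_trans, le_refl.
      + rewrite V1. intros Hn. apply HY.
        now apply (@cond_sound Z Y C C_arithmetical (fun q => q ∈ V')). }
  destruct refutes_def as [R HR].
  assert (HPR : forall e x w, P e x w <->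
    exists s, code_of s V w /\ pair (pair s w) (pair e x) ∈ R).
  { intros e x w. split.
    - intros H. destruct (code_exists V w) as [s Hs]. exists s; split; [exact Hs|].
      apply HR. revert H. apply refutes_mono; intros q [H1 H2]; split; auto; rewrite (Hs q); tauto.
    - intros (s & Hs & H). apply HR in H. revert H.
      apply refutes_mono; intros q [H1 H2]; rewrite (Hs q) in H2; tauto. }
  assert (HR1 : exists R1, forall z, z ∈ R1 <-> exists e x w, z = pair (pair e x) w /\
    exists s, code_of s V w /\ pair (pair s w) (pair e x) ∈ R) by comprehend.
  destruct HR1 as [R1 HR1].
  assert (HP1 : forall e x w, pair (pair e x) w ∈ R1 <-> P e x w).
  { intros e x w. rewrite HPR, HR1. split; [intros H; inj; eauto|].
    intros (s & H). exists e, x, w. eauto. }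
  intros v.
  assert (HR2 : exists R2, forall z, z ∈ R2 <-> exists e w, z = pair e w /\
    forall x, x <= v -> pair (pair e x) w ∈ R1) by comprehend.
  destruct HR2 as [R2 HR2].
  assert (HP2 : forall e w, pair e w ∈ R2 <-> forall x, x <= v -> P e x w).
  { intros e w. rewrite HR2. split.
    - intros (e' & w' & E & H) x Hx. inj. apply HP1; auto.
    - intros H. exists e, w. split; [reflexivity|]. intros x Hx. apply HP1; auto. }
  assert (Hc : eventually (fun w => forall e, e <= v -> pair e w ∈ R2)).
  { apply collection. intros e.
    assert (HR3 : exists R3, forall z, z ∈ R3 <-> exists x w, z = pair x w /\
      pair (pair e x) w ∈ R1) by comprehend.
    destruct HR3 as [R3 HR3].
    apply (@eventually_mono (fun w => forall x, x <= v -> pair x w ∈ R3) _).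
    - intros w H. apply HP2. intros x Hx. specialize (H x Hx).
      apply HR3 in H. destruct H as (x' & w' & E & H). inj. now apply HP1.
    - apply collection. intros x. apply (@eventually_mono (P e x) _); [|apply HP].
      intros w H. apply HR3. exists x, w. split; [reflexivity|]. now apply HP1. }
  destruct Hc as [w Hw]. exists w. intros s Hs e x He Hx.
  generalize (proj1 (HP2 e w) (Hw w (le_refl w) e He) x Hx).
  apply refutes_mono; intros q [H1 H2]; split; auto; rewrite (Hs q); tauto.
Qed.

(** For the set of 0 and 1, the number [pair 1 (pair 0 0)] would have to be decided below 1. A
    non-node marks the side of a separation that is opposite to a set of nodes. *)
Lemma not_every_node : exists c, ~ node (tree_ok Z C) c.
Proof.
  assert (HX : exists X, forall x, x ∈ X <-> x = 0 \/ x = 1) by comprehend.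
  destruct HX as [X HX]. destruct (code_exists X (1 + 1)) as [c Hc].
  exists c. intros [s Hs].
  assert (H01 : 0 < 1) by (rewrite <- (add_0_l 1); apply le_refl).
  assert (E0 : elem 0 c).
  { apply Hc. rewrite HX. split; [auto|]. now apply lt_le. }
  assert (E1 : elem 1 c).
  { apply Hc. rewrite HX. split; [auto|]. apply le_refl. }
  destruct (Hs 0 1 E0 E1 H01 0 0 (le_refl 0) (le_refl 0)) as [_ [H _]].
  apply (lt_irrefl 1). apply le_lt_trans with (pair 1 (pair 0 0)); [apply pair_le_l|exact H].
Qed.

Lemma connected_iff_valid X : (forall z, z ∈ X <-> space (node (tree_ok Z C)) z) ->
  ((csc X /\ forall A B, connects X (fun x => x ∈ A) (fun x => x ∈ B)) <->
   forall Y, sat M (env 0) (scons Y (fun _ => Z)) C).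
Proof.
  intros HX. destruct tree_ok_definable as [K HK].
  pose proof tree_ok_ext as Hext. pose proof tree_ok_mono as Hmono.
  pose proof tree_ok_anti as Hanti. rewrite <- HK in Hext, Hmono, Hanti.
  split.
  - intros [_ Hconn] Y. apply NNPP; intros HY.
    destruct (@counterexample_branch Y HY) as [V HV]. rewrite <- HK in HV.
    destruct (@branch_clopen K Hext Hmono V HV) as (S & S1 & S2 & S3 & S4).
    revert Hconn. apply (@clopen_disconnects _ X HX S S1 not_every_node); auto.
    now rewrite <- HK.
  - intros Hval. split; [now apply (@space_csc _ X HX)|].
    intros A B. apply (@no_clopen_connects _ X HX A B not_every_node).
    intros S S1 S2 S3. rewrite <- HK in S2.
    destruct (@clopen_branch K Hext Hanti S S1 S2 S3) as [V HV].
    unfold ok_set in HV. rewrite HK in HV.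
    destruct (@branch_counterexample V HV) as [Y HY]. auto.
Qed.
End Reduction.
End Model.

(** * Uniform definability *)

Ltac reify_hook ::=
  match goal with
  | HM : models ACA0 ?M, S0 : set ?M |- sat ?M _ _ _ <-> val _ _ _ _ =>
      eapply (@reify_val M HM S0); [reify_term|reify_term]
  | IH : forall M, models ACA0 M -> _ |- sat _ _ _ ?A <-> cond _ _ _ _ _ _ _ _ _ =>
      is_evar A; apply IH; assumption
  end.
Ltac reify_term_hook ::=
  match goal with
  | H : forall M rho t a, _ -> eval M rho (?c t) = ?d M a |- eval _ _ _ = ?d _ _ =>
      eapply H; reify_term
  end.

(** The recursion of [cond] descends into columns of columns; [c] and [d] are this descent as an
    operation on terms and on numbers. The formula is chosen before [M], so it serves all
    structures. *)
Lemma cond_definable B : arithmetical B ->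
  forall (c : term -> term) (d : forall M, num M -> num M),
  (forall M rho t a, eval M rho t = a -> eval M rho (c t) = d M a) ->
  exists A, arithmetical A /\ forall M, models ACA0 M -> set M -> forall rho sig s w e x Z,
    sat M (scons s (scons w (scons e (scons x rho)))) (scons Z sig) A <->
    cond M Z B (fun q => known_in M s w (d M q)) (fun q => known_out M s w (d M q))
      (fun a => known_in M s w (pair M (nzero M) a))
      (fun a => known_out M s w (pair M (nzero M) a)) e x.
Proof.
  induction B as [|s t|s t|t [|X]|B IHB C IHC|B IHB|B IHB]; cbn [arithmetical];
    intros HB c d Hcd.
  (* [cycle 1] lets [reify] construct the formula before it is checked to be arithmetical. *)
  1-5: eexists; split; cycle 1;
    [intros M HM S0 rho sig u w e x Z; cbn [cond]; reify|prove_arithmetical].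
  - destruct HB as [HB HC].
    destruct (IHB HB (fun t => c (tpair tone t)) (fun M q => d M (pair M (none M) q)))
      as [B' [aB' HB']].
    { intros M rho t a Ht. apply Hcd. unfold pair; simpl. now rewrite Ht. }
    destruct (IHC HC (fun t => c (tpair (tplus tone tone) t))
        (fun M q => d M (pair M (nadd M (none M) (none M)) q)))
      as [C' [aC' HC']].
    { intros M rho t a Ht. apply Hcd. unfold pair; simpl. now rewrite Ht. }
    clear IHB IHC.
    eexists; split; cycle 1;
      [intros M HM S0 rho sig u w e x Z; cbn [cond]; reify|prove_arithmetical].
  - destruct (IHB HB (fun t => c (tpair tone t)) (fun M q => d M (pair M (none M) q)))
      as [B' [aB' HB']].
    { intros M rho t a Ht. apply Hcd. unfold pair; simpl. now rewrite Ht. }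
    clear IHB.
    eexists; split; cycle 1;
      [intros M HM S0 rho sig u w e x Z; cbn [cond]; reify|prove_arithmetical].
  - destruct HB.
Qed.

Lemma refutes_formula C : arithmetical C ->
  exists A, arithmetical A /\ forall M, models ACA0 M -> set M -> forall rho sig s w e x Z,
    sat M (scons s (scons w (scons e (scons x rho)))) (scons Z sig) A <->
    refutes M Z C (known_in M s w) (known_out M s w) e x.
Proof.
  intros HC.
  destruct (@cond_definable C HC (fun t => tpair tone t) (fun M q => pair M (none M) q))
    as [C' [aC HC']].
  { intros M rho t a Ht. unfold pair; simpl. now rewrite Ht. }
  eexists; split; cycle 1;
    [intros M HM S0 rho sig u w e x Z; unfold refutes|].
  - eapply reify_and; [apply HC'; assumption|reify].
  - prove_arithmetical.
Qed.

Lemma reify_refutes C A :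
  (forall M, models ACA0 M -> set M -> forall rho sig s w e x Z,
    sat M (scons s (scons w (scons e (scons x rho)))) (scons Z sig) A <->
    refutes M Z C (known_in M s w) (known_out M s w) e x) ->
  forall M, models ACA0 M -> set M -> forall rho sig t1 t2 t3 t4 j s w e x Z,
  eval M rho t1 = s -> eval M rho t2 = w -> eval M rho t3 = e -> eval M rho t4 = x ->
  sig j = Z ->
  (sat M rho sig
    (subst (scons t1 (scons t2 (scons t3 (scons t4 (fun _ => tzero))))) (fun _ => j) A)
   <-> refutes M Z C (known_in M s w) (known_out M s w) e x).
Proof.
  intros HA M HM S0 rho sig t1 t2 t3 t4 j s w e x Z <- <- <- <- <-.
  eapply reify_subst; [apply (HA M HM S0)| |].
  - intros [|[|[|[|n]]]]; reflexivity.
  - intros [|X]; reflexivity.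
Qed.

Ltac reify_hook ::=
  match goal with
  | HM : models ACA0 ?M, S0 : set ?M, HA : forall M, models ACA0 M -> _
    |- sat ?M _ _ _ <-> refutes _ _ _ _ _ _ _ =>
      eapply (@reify_refutes _ _ HA M HM S0); [reify_term|reify_term|reify_term|reify_term|reify_var]
  end.

Lemma refutes_definable_arithmetical C M : arithmetical C -> models ACA0 M ->
  forall Z, refutes_definable M Z C.
Proof.
  intros HC HM Z. destruct (@refutes_formula C HC) as [A [aA HA]].
  assert (S0 : set M) by exact Z.
  assert (H : exists R, forall z, nmem M z R <-> exists s w e x,
    z = pair M (pair M s w) (pair M e x) /\
    refutes M Z C (known_in M s w) (known_out M s w) e x).
  { comprehend. }
  destruct H as [R HR]. exists R. intros s w e x. rewrite HR. split.
  - intros (s' & w' & e' & x' & E & H).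
    apply (pair_inj HM S0) in E. destruct E as [E1 E2].
    apply (pair_inj HM S0) in E1, E2. destruct E1 as [-> ->], E2 as [-> ->]. exact H.
  - intros H. exists s, w, e, x. auto.
Qed.

Lemma space_formula C : arithmetical C ->
  exists D, arithmetical D /\ forall M, models ACA0 M -> set M -> forall rho sig z Z,
    sat M (scons z rho) (scons Z sig) D <-> space M (node M (tree_ok M Z C)) z.
Proof.
  intros HC. destruct (@refutes_formula C HC) as [A [aA HA]].
  eexists; split; cycle 1; [intros M HM S0 rho sig z Z; reify|prove_arithmetical].
Qed.

(** Enforces [bounded] on a formula whose truth depends on few variables only. *)
Definition close (k l : nat) (A : formula) : formula :=
  subst (fun n => if n <? k then tvar n else tzero) (Nat.min l) A.

Lemma bounded_close k l A : bounded k (S l) (close k l A).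
Proof.
  apply bounded_subst; [|intros X; lia].
  intros n. destruct (n <? k) eqn:E; simpl; [now apply Nat.ltb_lt|exact I].
Qed.

Lemma reify_close M rho sig k l A P rho' sig' :
  (sat M rho' sig' A <-> P) ->
  (forall n, rho' n = if n <? k then rho n else nzero M) ->
  (forall X, sig' X = sig (Nat.min l X)) ->
  (sat M rho sig (close k l A) <-> P).
Proof.
  intros HP Hr Hs. eapply reify_subst; [exact HP| |now intros].
  intros n. rewrite Hr. now destruct (n <? k).
Qed.

(** A bounded formula equals its own [close], whose truth reads only the listed variables; this
    replaces an induction on [A]. *)
Lemma sat_bounded M A k l rho sig rho' sig' : bounded k (S l) A ->
  (forall n, n < k -> rho n = rho' n) -> (forall X, X <= l -> sig X = sig' X) ->
  (sat M rho sig A <-> sat M rho' sig' A).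
Proof.
  intros HA Hr Hs.
  assert (E : close k l A = A).
  { rewrite <- (subst_id A) at 2. unfold close. eapply subst_bounded; [exact HA| |].
    - intros n Hn. apply Nat.ltb_lt in Hn. now rewrite Hn.
    - intros X HX. lia. }
  transitivity (sat M (fun n => if n <? k then rho n else nzero M)
                  (fun X => sig (Nat.min l X)) A); [|symmetry];
    rewrite <- E at 1; (eapply reify_close; [reflexivity|..]); auto.
  - intros n; cbv beta. destruct (n <? k) eqn:En; [|reflexivity]. apply Hr. now apply Nat.ltb_lt.
  - intros X. apply Hs. lia.
Qed.

(** * The two halves of universality *)

Lemma connected_CSC_space_Pi11 :
  exists Q, Pi11 Q /\ bounded 0 1 Q /\ proves ACA0 (∀S (connected_CSC_space ⇔ Q))%f.
Proof.
  assert (H : exists A, arithmetical A /\ forall M, forall rho sig Z C,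
    sat M rho (scons C (scons Z sig)) A <-> csc M Z /\
      connects M Z (fun x => nmem M (pair M (nzero M) x) C)
                   (fun x => nmem M (pair M (none M) x) C)).
  { eexists; split; cycle 1; [intros M rho sig Z C; reify|prove_arithmetical]. }
  destruct H as [A [aA HA]]. exists (falls (close 0 1 A)). split; [|split].
  - exists (close 0 1 A). split; [now apply arithmetical_subst|reflexivity].
  - apply bounded_close.
  - apply completeness; [apply ACA0_subst_closed|].
    intros M HM rho sig Z.
    refine (proj2 (@reify_iff M rho (scons Z sig) _ (falls (close 0 1 A)) _
      (forall C, csc M Z /\
        connects M Z (fun x => nmem M (pair M (nzero M) x) C)
                     (fun x => nmem M (pair M (none M) x) C))
      (sat_connected_CSC_space M rho sig Z) _) _).
    { apply reify_alls; intros C.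
      apply reify_close with (fun _ => nzero M) (scons C (scons Z (fun _ => Z))).
      - apply HA.
      - now intros n.
      - now intros [|[|X]]. }
    split.
    + intros [H1 H2] C. split; [exact H1|].
      assert (HC : forall i, exists B, forall x, nmem M x B <-> nmem M (pair M i x) C).
      { intros i. comprehend. }
      destruct (HC (nzero M)) as [A0 H0], (HC (none M)) as [A1 H1'].
      specialize (H2 A0 A1).
      replace (fun x => nmem M (pair M (nzero M) x) C) with (fun x => nmem M x A0)
        by (apply functional_extensionality; intros; now apply propositional_extensionality).
      replace (fun x => nmem M (pair M (none M) x) C) with (fun x => nmem M x A1)
        by (apply functional_extensionality; intros; now apply propositional_extensionality).
      exact H2.
    (* The conjunct on the space sits under the set quantifier; [Z] is an instance at hand. *)
    + intros H. split; [apply (H Z)|]. intros A0 A1.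
      assert (HC : exists C, forall z, nmem M z C <->
        (exists x, z = pair M (nzero M) x /\ nmem M x A0) \/
        (exists x, z = pair M (none M) x /\ nmem M x A1)).
      { comprehend. }
      destruct HC as [C HC]. destruct (H C) as [_ HCC].
      replace (fun x => nmem M x A0) with (fun x => nmem M (pair M (nzero M) x) C).
      1: replace (fun x => nmem M x A1) with (fun x => nmem M (pair M (none M) x) C);
           [exact HCC|].
      all: apply functional_extensionality; intros x; apply propositional_extensionality;
        rewrite HC; split; [intros [(y & E & Hy)|(y & E & Hy)]|eauto];
        apply (pair_inj HM Z) in E; destruct E as [E ->]; auto;
        destruct (zero_neq_one HM Z); auto.
Qed.

Lemma connected_CSC_space_Pi11_hard F : Pi11 F -> bounded 0 1 F ->
  exists D, arithmetical D /\ bounded 1 1 D /\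
    proves ACA0
      (∀S ∃S ((∀N (#0 ∈ 0 ⇔ shift_set D)) ∧ (shift_set F ⇔ connected_CSC_space)))%f.
Proof.
  intros (C & aC & ->) HC. simpl in HC.
  destruct (@space_formula C aC) as [D [aD HD]].
  exists (close 1 0 D). split; [now apply arithmetical_subst|split; [apply bounded_close|]].
  apply completeness; [apply ACA0_subst_closed|].
  intros M HM rho sig Z.
  destruct (@comprehension_formula M (close 1 0 D) rho (scons Z sig) HM) as [X HX];
    [now apply arithmetical_subst|].
  apply (@reify_exs M rho (scons Z sig) _ (fun X =>
    (forall n, nmem M n X <-> sat M (scons n rho) (scons Z sig) (close 1 0 D)) /\
    (sat M rho (scons Z sig) (falls C) <-> sat M rho (scons X (scons Z sig)) connected_CSC_space))).
  { intros X'. apply reify_and.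
    - apply reify_all; intros n. apply reify_iff; [reflexivity|apply sat_shift_set].
    - apply reify_iff; [apply sat_shift_set|reflexivity]. }
  exists X. split; [exact HX|].
  rewrite sat_connected_CSC_space.
  rewrite (@connected_iff_valid M HM Z Z C aC (@refutes_definable_arithmetical C M aC HM Z) X).
  (* [C] has no free number variables and only the set variables 0 and 1, so [env 0] may stand for
     [rho], and the constant assignment [Z] for [scons Z sig]. *)
  - simpl. split; intros H Y; generalize (H Y); apply sat_bounded with (k := 0) (l := 1); auto;
      try (intros; lia); intros [|[|X']] HX'; auto; lia.
  - intros z. rewrite HX. apply reify_close with (scons z (fun _ => nzero M)) (scons Z (fun _ => Z)).
    + now apply HD.
    + now intros [|n].
    + now intros [|n].
Qed.

Theorem theorem14p2 : Pi11_universal connected_CSC_space.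
Proof.
  split.
  - exact connected_CSC_space_Pi11.
  - exact connected_CSC_space_Pi11_hard.
Qed.
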